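(* Let $\Omega\subset\mathbb{R}^n$ be a bounded $C^2$ domain with unit inner normal $\nu$ and let $u\in C^2(\bar\Omega)$ satisfy $$D^2u\ge-\mu_0(1+|Du|^2)I\quad\text{in }\Omega,$$ where $\mu_0\ge0$ is a constant, and $$|D_\beta u|\le\sigma_0,\qquad\beta\cdot\nu\ge\beta_0\quad\text{on }\partial\Omega,$$ where $\beta\in L^\infty(\partial\Omega)$ is a vector field with $|\beta|=1$ and $\sigma_0,\beta_0$ are positive constants. Then $$|Du|\le C\quad\text{in }\Omega,$$ where $C$ depends only on $\mu_0,\sigma_0,\beta_0,\Omega$ and $\sup_\Omega|u|$.
   Context: $D_\beta u=\beta\cdot Du$; $I$ is the identity matrix and matrix inequalities are in the sense of symmetric matrices. *)

(* Defs.v *)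
From HB Require Import structures.
From mathcomp Require Import all_boot all_order all_algebra.
From mathcomp Require Import all_classical all_reals all_analysis.
Set Implicit Arguments.
Unset Strict Implicit.
Unset Printing Implicit Defensive.
Import Order.TTheory GRing.Theory Num.Theory.
Import numFieldNormedType.Exports.
Local Open Scope classical_set_scope.
Local Open Scope ring_scope.

(* The library norm `|v| on row vectors is the sup norm; the Euclidean
   structure is therefore introduced separately. *)
Definition dot (R : realType) (n : nat) (v w : 'rV[R]_n) : R :=
  \sum_i v 0 i * w 0 i.

Definition enorm (R : realType) (n : nat) (v : 'rV[R]_n) : R :=
  Num.sqrt (dot v v).

Definition eball (R : realType) (n : nat) (c : 'rV[R]_n) (r : R) :
  set 'rV[R]_n := [set x | enorm (x - c) < r].

(* Order of symmetric matrices through their quadratic forms. *)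
Definition mx_le (R : realType) (n : nat) (A B : 'M[R]_n) : Prop :=
  forall xi : 'rV[R]_n, dot (xi *m A) xi <= dot (xi *m B) xi.

Definition boundary (T : topologicalType) (A : set T) : set T :=
  closure A `\` interior A.

(* Rows of D2f are indexed by the direction of the second differentiation:
   D2f i j is the partial derivative in direction i of the j-th entry of Df. *)
Definition derivs2 (R : realType) (n : nat) (A : set 'rV[R]_n)
    (f : 'rV[R]_n -> R) (Df : 'rV[R]_n -> 'rV[R]_n)
    (D2f : 'rV[R]_n -> 'M[R]_n) : Prop :=
  forall x, A x ->
    is_diff x f (fun h : 'rV[R]_n => dot (Df x) h) /\
    is_diff x Df (fun h : 'rV[R]_n => h *m D2f x).

(* u is C^2 in W and u, Du, D2u extend continuously to the closure of W; the
   values of u, Du, D2u at boundary points are those of the extensions. *)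
Definition C2_closure (R : realType) (n : nat) (W : set 'rV[R]_n)
    (u : 'rV[R]_n -> R) (Du : 'rV[R]_n -> 'rV[R]_n)
    (D2u : 'rV[R]_n -> 'M[R]_n) : Prop :=
  [/\ derivs2 W u Du D2u,
      {within closure W, continuous u},
      {within closure W, continuous Du} &
      {within closure W, continuous D2u}].

(* rho is a C^2 function near x0 with nonvanishing gradient Drho, and W is
   {rho > 0} near x0. *)
Definition C2_defining (R : realType) (n : nat) (W : set 'rV[R]_n)
    (x0 : 'rV[R]_n) (rho : 'rV[R]_n -> R)
    (Drho : 'rV[R]_n -> 'rV[R]_n) : Prop :=
  exists U : set 'rV[R]_n, exists D2rho : 'rV[R]_n -> 'M[R]_n,
    [/\ open U /\ U x0,
        derivs2 U rho Drho D2rho,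
        {in U, continuous D2rho},
        (forall x, U x -> Drho x != 0) &
        forall x, U x -> (W x <-> 0 < rho x)].

Definition bounded_C2_domain (R : realType) (n : nat)
    (W : set 'rV[R]_n) : Prop :=
  [/\ W !=set0, open W, connected W, bounded_set W &
      forall x0, boundary W x0 ->
        exists rho Drho, C2_defining W x0 rho Drho].

(* The unit inner normal at a boundary point is the normalized gradient of a
   defining function; it does not depend on the choice of that function.
   The value at other points is irrelevant. *)
Definition is_inner_normal (R : realType) (n : nat) (W : set 'rV[R]_n)
    (x nu : 'rV[R]_n) : Prop :=
  exists rho Drho, C2_defining W x rho Drho /\
    nu = (enorm (Drho x))^-1 *: Drho x.

Definition inner_normal (R : realType) (n : nat) (W : set 'rV[R]_n)
    (x : 'rV[R]_n) : 'rV[R]_n := xget 0 [set nu | is_inner_normal W x nu].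

(* N has zero s-dimensional Hausdorff measure. The covers are indexed by
   subsets of nat so that finite and empty covers are allowed; this matters
   for s = 0, where each ball costs 1 and only the empty set is null. *)
Definition hausdorff_null (R : realType) (n s : nat)
    (N : set 'rV[R]_n) : Prop :=
  forall e d : R, 0 < e -> 0 < d ->
    exists (I : set nat) (c : nat -> 'rV[R]_n) (r : nat -> R),
      [/\ forall k, I k -> 0 < r k < d,
          N `<=` \bigcup_(k in I) eball (c k) (r k) &
          (\esum_(k in I) (r k ^+ s)%:E < e%:E)%E].

(* Almost everywhere on the boundary of W for surface measure, i.e. for the
   (n - 1)-dimensional Hausdorff measure. *)
Definition boundary_ae (R : realType) (n : nat) (W : set 'rV[R]_n)
    (P : 'rV[R]_n -> Prop) : Prop :=
  exists N : set 'rV[R]_n, hausdorff_null n.-1 N /\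
    forall x, boundary W x -> ~ N x -> P x.

(* Only the values of b on the boundary of W matter. Measurability is for the
   surface measure: preimages of open sets are Borel up to null sets. *)
Definition boundary_Linfty (R : realType) (n : nat) (W : set 'rV[R]_n)
    (b : 'rV[R]_n -> 'rV[R]_n) : Prop :=
  (forall V : set 'rV[R]_n, open V ->
     exists B : set 'rV[R]_n, <<s open >> B /\
       boundary_ae W (fun x => V (b x) <-> B x)) /\
  exists M : R, boundary_ae W (fun x => enorm (b x) <= M).

(* Main.v *)
(** The gradient is bounded first on the boundary. Let D'u be the tangential
    gradient. Obliqueness controls the normal derivative there:
    beta0 |D_nu u| <= sigma0 + |D'u|, almost everywhere by hypothesis and then
    everywhere by continuity, because a set of zero (n-1)-dimensional Hausdorff
    measure contains no relatively open piece of the boundary. Now maximize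
    |D'u| exp(K u) over the boundary. If q = |D'u| > 1 at the maximum point, move
    along the boundary in the direction tau = D'u / q: the logarithm of the
    function has derivative
    [tau.D2u.tau - (curvature in direction tau) D_nu u] / q + K q, where the
    bracket is at least -(K - 1) q^2 for a suitable K given by mu0, sigma0,
    beta0 and the curvature of the boundary. This is positive, a contradiction;
    hence q <= 1 at the maximum. In the interior the same argument works for
    |Du| exp((2 mu0 + 1) u) along the direction Du / |Du|. *)
Require Import Defs.
From HB Require Import structures.
From mathcomp Require Import all_boot all_order all_algebra.
From mathcomp Require Import all_classical all_reals all_analysis.
From mathcomp Require Import ring lra zify.
Set Implicit Arguments.
Unset Strict Implicit.
Unset Printing Implicit Defensive.
Import Order.TTheory GRing.Theory Num.Theory.
Import numFieldNormedType.Exports.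
Local Open Scope classical_set_scope.
Local Open Scope ring_scope.

(** * Euclidean structure on row vectors *)

Section Euclidean.
Context {R : realType} {n : nat}.
Implicit Types v w x : 'rV[R]_n.

Lemma dotC v w : dot v w = dot w v.
Proof. by apply: eq_bigr => i _; rewrite mulrC. Qed.

Lemma dotDl v w x : dot (v + w) x = dot v x + dot w x.
Proof. by rewrite -big_split; apply: eq_bigr => i _; rewrite mxE mulrDl. Qed.

Lemma dotZl a v w : dot (a *: v) w = a * dot v w.
Proof. by rewrite mulr_sumr; apply: eq_bigr => i _; rewrite mxE mulrA. Qed.

Lemma dotDr v w x : dot x (v + w) = dot x v + dot x w.
Proof. by rewrite dotC dotDl !(dotC x). Qed.

Lemma dotZr a v w : dot v (a *: w) = a * dot v w.
Proof. by rewrite dotC dotZl dotC. Qed.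

Lemma dotNl v w : dot (- v) w = - dot v w.
Proof. by rewrite -scaleN1r dotZl mulN1r. Qed.

Lemma dotNr v w : dot v (- w) = - dot v w.
Proof. by rewrite dotC dotNl dotC. Qed.

Lemma dotBl v w x : dot (v - w) x = dot v x - dot w x.
Proof. by rewrite dotDl dotNl. Qed.

Lemma dotBr v w x : dot x (v - w) = dot x v - dot x w.
Proof. by rewrite dotDr dotNr. Qed.

Lemma dot0l v : dot 0 v = 0.
Proof. by rewrite -(scale0r 0) dotZl mul0r. Qed.

Lemma dot_ge0 v : 0 <= dot v v.
Proof. by apply: sumr_ge0 => i _; rewrite -expr2 sqr_ge0. Qed.

Lemma dot_eq0 v : dot v v = 0 -> v = 0.
Proof.
move=> /eqP; rewrite psumr_eq0 => [/allP v0|i _]; last by rewrite -expr2 sqr_ge0.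
apply/rowP => i; have := v0 i (mem_index_enum _); rewrite /= mulf_eq0 orbb mxE.
by move=> /eqP.
Qed.

Lemma enorm_ge0 v : 0 <= enorm v.
Proof. exact: sqrtr_ge0. Qed.

Lemma enorm_sqr v : enorm v ^+ 2 = dot v v.
Proof. by rewrite sqr_sqrtr ?dot_ge0. Qed.

Lemma enorm_gt0 v : v != 0 -> 0 < enorm v.
Proof.
move=> v0; rewrite lt_def enorm_ge0 andbT; apply: contra v0 => /eqP v0.
by apply/eqP/dot_eq0; rewrite -enorm_sqr v0 expr0n.
Qed.

Lemma dot_gt0 v : v != 0 -> 0 < dot v v.
Proof. by move=> /enorm_gt0 v0; rewrite -enorm_sqr exprn_gt0. Qed.

Lemma enormZ a v : 0 <= a -> enorm (a *: v) = a * enorm v.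
Proof.
by move=> a0; rewrite /enorm dotZl dotZr mulrA sqrtrM ?mulr_ge0// -expr2 sqrtr_sqr ger0_norm.
Qed.

Lemma enorm_normalized v : v != 0 -> enorm ((enorm v)^-1 *: v) = 1.
Proof.
by move=> /enorm_gt0 v0; rewrite enormZ ?invr_ge0 1?ltW// mulVf ?gt_eqF.
Qed.

Lemma cauchy_schwarz v w : `|dot v w| <= enorm v * enorm w.
Proof.
have [->|w0] := eqVneq w 0.
  by rewrite dotC dot0l normr0 mulr_ge0 ?enorm_ge0.
rewrite -ler_sqr ?nnegrE ?mulr_ge0 ?enorm_ge0// real_normK ?num_real//.
rewrite exprMn !enorm_sqr.
(* In the abbreviations introduced below, this square expands to [c * (a * c - b ^+ 2)], and [c] is
   positive. *)
have := dot_ge0 (dot w w *: v - dot v w *: w).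
rewrite !(dotBl, dotBr, dotZl, dotZr) (dotC w v).
have := dot_gt0 w0; move: (dot v v) (dot v w) (dot w w) => a b c c0 H.
rewrite -subr_ge0 -(pmulr_lge0 _ c0).
by apply: le_trans H _; rewrite le_eqVlt; apply/orP; left; apply/eqP; ring.
Qed.

Lemma coord_le_norm v i : `|v 0 i| <= `|v|.
Proof.
rewrite [leRHS]mx_normrE.
exact: (le_bigmax _ (fun ij => `|v ij.1 ij.2|) (0, i)).
Qed.

(** Neighbourhoods are measured in the sup norm [|v|], so the local estimates use it; the factor [n]
    is the price of pairing it with the Euclidean product. *)
Lemma abs_dot_le v w : `|dot v w| <= n%:R * `|v| * `|w|.
Proof.
apply: le_trans (ler_norm_sum _ _ _) _.
have -> : n%:R * `|v| * `|w| = \sum_(i < n) `|v| * `|w|.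
  by rewrite sumr_const card_ord -mulrA mulr_natl.
by apply: ler_sum => i _; rewrite normrM ler_pM ?coord_le_norm.
Qed.

Lemma coord_le_enorm v i : `|v 0 i| <= enorm v.
Proof.
rewrite -ler_sqr ?nnegrE ?enorm_ge0// enorm_sqr real_normK ?num_real//.
rewrite /dot (bigD1 i)//= -expr2 lerDl.
by apply: sumr_ge0 => j _; rewrite -expr2 sqr_ge0.
Qed.

Lemma norm_le_coord v (a : R) : 0 <= a -> (forall i, `|v 0 i| <= a) -> `|v| <= a.
Proof.
move=> a0 va; rewrite [leLHS]mx_normrE; apply/bigmax_leP; split => // -[i j] _.
by rewrite ord1 va.
Qed.

Lemma norm_le_enorm v : `|v| <= enorm v.
Proof. by apply: norm_le_coord => [|i]; [exact: enorm_ge0|exact: coord_le_enorm]. Qed.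

Lemma cvg_dot (T : Type) (F : set_system T) {FF : Filter F} (f g : T -> 'rV[R]_n) v w :
  f @ F --> v -> g @ F --> w -> dot (f x) (g x) @[x --> F] --> dot v w.
Proof.
move=> fv gw; rewrite /dot.
apply: (@cvg_big R^o) => [|i _]; first exact: add_continuous.
apply: (@cvgM R); exact: continuous_cvg (@coord_continuous _ _ _ _ _ _) _.
Qed.

Lemma cvg_enorm (T : Type) (F : set_system T) {FF : Filter F} (f : T -> 'rV[R]_n) v :
  f @ F --> v -> enorm (f x) @[x --> F] --> enorm v.
Proof.
move=> fv; rewrite /enorm; apply: continuous_cvg; first exact: sqrt_continuous.
exact: cvg_dot.
Qed.

Lemma mulmx_norm_le v (B : 'M[R]_n) : `|v *m B| <= n%:R * `|v| * `|B|.
Proof.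
apply: norm_le_coord => [|i]; first by rewrite !mulr_ge0.
have -> : (v *m B) 0 i = dot v (\row_j B j i).
  by rewrite mxE; apply: eq_bigr => j _; rewrite mxE.
apply: le_trans (abs_dot_le _ _) _; rewrite ler_wpM2l ?mulr_ge0//.
apply: norm_le_coord => // j; rewrite mxE [leRHS]mx_normrE.
exact: (le_bigmax _ (fun ij => `|B ij.1 ij.2|) (j, i)).
Qed.

Lemma norm_trmx_le (B : 'M[R]_n) : `|B^T| <= `|B|.
Proof.
rewrite [leLHS]mx_normrE; apply/bigmax_leP; split => // -[i j] _.
rewrite mxE [leRHS]mx_normrE.
exact: (le_bigmax _ (fun ij => `|B ij.1 ij.2|) (j, i)).
Qed.

Lemma cvg_mulmx_tr (T : Type) (F : set_system T) {FF : Filter F} v (f : T -> 'M[R]_n) B :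
  f @ F --> B -> v *m (f t)^T @[t --> F] --> v *m B^T.
Proof.
move=> /cvgrPdist_le fB; apply/cvgrPdist_le => e e0.
have c0 : 0 < n%:R * `|v| + 1 by rewrite ltr_wpDl// mulr_ge0.
have := fB (e / (n%:R * `|v| + 1)); rewrite divr_gt0// => /(_ isT).
apply: filterS => t; rewrite ler_pdivlMr// => H.
rewrite -mulmxBr -linearB; apply: le_trans (mulmx_norm_le _ _) _.
apply: le_trans H; rewrite mulrC ler_pM ?norm_trmx_le ?mulr_ge0//.
by rewrite lerDl.
Qed.

Lemma dot_mulmx_tr v w (B : 'M[R]_n) : dot (v *m B^T) w = dot (w *m B) v.
Proof.
rewrite /dot; under eq_bigr do rewrite mxE mulr_suml.
rewrite exchange_big /=; apply: eq_bigr => i _.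
rewrite mxE mulr_suml; apply: eq_bigr => j _.
by rewrite mxE; ring.
Qed.

Definition tang v nu := v - dot v nu *: nu.

Lemma dot_tang v nu : enorm nu = 1 -> dot (tang v nu) nu = 0.
Proof. by move=> nu1; rewrite dotBl dotZl -enorm_sqr nu1 expr1n mulr1 subrr. Qed.

Lemma dot_tangE v w nu : dot (tang v nu) w = dot v w - dot v nu * dot nu w.
Proof. by rewrite dotBl dotZl. Qed.

Lemma enorm_sqr_tang v nu : enorm nu = 1 ->
  enorm v ^+ 2 = enorm (tang v nu) ^+ 2 + dot v nu ^+ 2.
Proof.
move=> nu1; rewrite (enorm_sqr (tang _ _)) {2}/tang dotBr dotZr dot_tang// mulr0 subr0.
by rewrite dot_tangE -enorm_sqr (dotC nu) -expr2 subrK.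
Qed.

(** Splitting [v] into normal and tangential parts gives [dot v nu * dot b nu = dot b v - dot b
    (tang v nu)], and Cauchy-Schwarz with [enorm b = 1] bounds the last product. *)
Lemma oblique_normal (sigma0 beta0 : R) v nu b :
  enorm nu = 1 -> enorm b = 1 -> `|dot b v| <= sigma0 -> beta0 <= dot b nu ->
  beta0 * `|dot v nu| <= sigma0 + enorm (tang v nu).
Proof.
move=> nu1 b1 bv bnu.
have bt : `|dot b (tang v nu)| <= enorm (tang v nu).
  by rewrite (le_trans (cauchy_schwarz _ _))// b1 mul1r.
have e : dot v nu * dot b nu = dot b v - dot b (tang v nu).
  by rewrite dotBr dotZr opprB addrC subrK.
apply: le_trans (lerD bv bt); apply: le_trans (ler_normB _ _).
by rewrite -e normrM mulrC ler_wpM2l// (le_trans bnu) ?ler_norm.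
Qed.

End Euclidean.

(** * Mean value theorem along segments *)

Section Segment.
Context {R : realType} {n : nat}.
Implicit Types (a h l w x : 'rV[R]_n) (A : set 'rV[R]_n).

Lemma is_diff_dotr w x : is_diff x (fun v => dot v w) (fun v => dot v w).
Proof.
have dlin : linear (fun v => dot v w) by move=> k u v; rewrite dotDl dotZl.
pose dM := GRing.isLinear.Build _ _ _ _ _ dlin.
pose dL : {linear 'rV[R]_n -> R} := HB.pack (fun v => dot v w) dM.
have dc : continuous dL.
  move=> y; exact: (@cvg_dot R n _ (nbhs y) _ id (cst w) y w cvg_id (cvg_cst _)).
rewrite (_ : (fun _ => _) = dL) //.
by apply: DiffDef; [exact: linear_differentiable|exact: diff_lin].
Qed.

(** Since rows of [M] are indexed by the direction of differentiation, the gradient of a fixed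
    component of [f] carries the transpose. *)
Lemma is_diff_dot (f : 'rV[R]_n -> 'rV[R]_n) (M : 'M[R]_n) w x :
  is_diff x f (fun h => h *m M) ->
  is_diff x (fun y => dot (f y) w) (fun h => dot (w *m M^T) h).
Proof.
move=> df; have := is_diff_comp df (is_diff_dotr w (f x)).
rewrite /comp => H; apply: is_diff_eq H _.
by apply/funext => h; rewrite /= dot_mulmx_tr.
Qed.

Lemma is_diff_segment a h (t : R) :
  is_diff t (fun s => a + s *: h) (fun s => s *: h).
Proof.
have H := is_diffD (is_diff_cst a t) (is_diff_scalel t h).
apply: is_diff_eq H _.
by rewrite add0r.
Qed.

(** Differentiability is asked only strictly between the end points and continuity only relative to
    [A], so that a segment may start or end on the boundary of the domain. *)
Lemma mean_value_segment A (g : 'rV[R]_n -> R) (dg : 'rV[R]_n -> 'rV[R]_n) a h :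
  (forall t : R, 0 < t < 1 ->
     is_diff (a + t *: h) g (fun v => dot (dg (a + t *: h)) v)) ->
  {within A, continuous g} -> (forall t : R, 0 <= t <= 1 -> A (a + t *: h)) ->
  exists2 t : R, 0 < t < 1 & g (a + h) - g a = dot (dg (a + t *: h)) h.
Proof.
move=> gd gA Aah.
have gc : {within `[(0 : R), 1], continuous (fun t => g (a + t *: h))}.
  apply/subspace_continuousP => t; rewrite /= in_itv /= => t01.
  move/subspace_continuousP : gA => /(_ _ (Aah _ t01)); apply: cvg_comp.
  have segc : a + s *: h @[s --> t] --> a + t *: h.
    by apply: cvgD; [exact: cvg_cst|apply: cvgZr_tmp; exact: cvg_id].
  move=> V /= HV; have H : \forall s \near t, A (a + s *: h) -> V (a + s *: h) := segc _ HV.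
  suff : \forall s \near t, `[(0 : R), 1]%classic s -> V (a + s *: h) by [].
  apply: filterS H => s /= + s01; apply; apply: Aah.
  by move: s01; rewrite /= in_itv.
have [|t t01 e] := MVT (@ltr01 R) _ gc (df := fun t => dot (dg (a + t *: h)) h).
  move=> t; rewrite in_itv /= => t01.
  have [gd1 gd2] := is_diff_comp (is_diff_segment a h t) (gd t t01).
  rewrite /comp in gd1 gd2.
  apply: DeriveDef; first exact: diff_derivable.
  by rewrite deriveE// gd2 scale1r.
exists t; first by move: t01; rewrite in_itv.
by move: e; rewrite scale1r scale0r addr0 subr0 mulr1.
Qed.

End Segment.

(** * First-order expansions relative to a set *)

Section RelDiff.
Context {R : realType} {n : nat}.
Implicit Types (a h l w x : 'rV[R]_n) (A : set 'rV[R]_n).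

(* Du need not be differentiable at a boundary point in the sense of [is_diff],
   since its values outside the closure are arbitrary. *)
Definition rel_diff A x (g : 'rV[R]_n -> R) l :=
  forall e : R, 0 < e ->
    \forall y \near x, A y -> `|g y - g x - dot l (y - x)| <= e * `|y - x|.

Lemma is_diff_rel_diff A x g l : is_diff x g (fun h => dot l h) -> rel_diff A x g l.
Proof.
move=> [gd gE] e e0.
have /eqaddoP /(_ e e0) := diff_locally gd.
rewrite gE => H.
have c : y - x @[y --> x] --> (0 : 'rV[R]_n).
  rewrite -(subrr x).
  exact: (@cvgB R _ _ (nbhs x) _ id (cst x) x x cvg_id (cvg_cst x)).
have {H c} : \forall y \near x,
  `|(g \o shift x - (cst (g x) + dot l)) (y - x)| <= e * `|y - x| := c _ H.
apply: filterS => y + _.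
by rewrite -[X in `|X| <= _ -> _]/(g (y - x + x) - (g x + dot l (y - x))) subrK opprD addrA.
Qed.

(** Only first-order contact at [0^'+] is required, with no regularity at positive times; such an
    [X] can therefore be obtained by choice. *)
Definition tangent_path A x (X : R -> 'rV[R]_n) h :=
  (\forall t \near 0^'+, A (X t)) /\ t^-1 *: (X t - x) @[t --> 0^'+] --> h.

Lemma tangent_path_cvg A x X h : tangent_path A x X h -> X t @[t --> 0^'+] --> x.
Proof.
move=> [_ Xh].
have : t *: (t^-1 *: (X t - x)) + x @[t --> 0^'+] --> (0 : R) *: h + x.
  apply: cvgD; last exact: cvg_cst.
  apply: cvgZ => //; apply: cvg_at_right_filter; exact: cvg_id.
rewrite scale0r add0r; apply: cvg_trans; apply: near_eq_cvg.
near=> t; rewrite scalerA divff ?scale1r ?subrK//.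
Unshelve. all: by end_near. Qed.

Lemma rel_diff_path A x g l X h : rel_diff A x g l -> tangent_path A x X h ->
  t^-1 * (g (X t) - g x) @[t --> 0^'+] --> dot l h.
Proof.
move=> gl XP; have Xx := tangent_path_cvg XP; have [XA Xh] := XP.
have lX : dot l (t^-1 *: (X t - x)) @[t --> 0^'+] --> dot l h.
  by apply: cvg_dot => //; exact: cvg_cst.
have : t^-1 * (g (X t) - g x) - dot l (t^-1 *: (X t - x)) @[t --> 0^'+] --> (0 : R).
  have bd : \forall t \near 0^'+, `|t^-1 *: (X t - x)| <= `|h| + 1.
    move/cvgrPdist_le : Xh => /(_ 1 ltr01); apply: filterS => t.
    rewrite distrC -[X in `|X| <= _ -> _]/(_) => /(le_trans (lerB_dist _ _)).
    by rewrite lerBlDl.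
  apply/cvgrPdist_le => e e0.
  (* The remainder of [g] is measured against [|X t - x|], which is at most [(|h| + 1) t] for small
     [t]. *)
  have e'0 : 0 < e / (`|h| + 1) by rewrite divr_gt0// ltr_wpDl.
  have := Xx _ (gl _ e'0) => gX.
  near=> t; rewrite sub0r normrN.
  have t0 : 0 < t by near: t; exact: nbhs_right_gt.
  rewrite dotZr -mulrBr normrM gtr0_norm ?invr_gt0//.
  have XAt : A (X t) by near: t.
  have gXt : A (X t) -> `|g (X t) - g x - dot l (X t - x)| <= e / (`|h| + 1) * `|X t - x|.
    by near: t.
  have bdt : `|t^-1 *: (X t - x)| <= `|h| + 1 by near: t.
  move: bdt; rewrite normrZ gtr0_norm ?invr_gt0// => bdt.
  apply: le_trans (_ : t^-1 * (e / (`|h| + 1) * `|X t - x|) <= _).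
    by rewrite ler_pM2l ?invr_gt0// gXt.
  rewrite mulrCA; apply: le_trans (_ : e / (`|h| + 1) * (`|h| + 1) <= _).
    by rewrite ler_pM2l.
  by rewrite divfK// lt0r_neq0// ltr_wpDl.
move=> H; rewrite -[dot l h]add0r.
under eq_fun => t do rewrite -(subrK (dot l (t^-1 *: (X t - x))) (_ * _)).
exact: (cvgD H lX).
Unshelve. all: by end_near. Qed.

End RelDiff.

(* The one-sided derivative of f exp(K w) at 0 is (a + K q^2) exp(K u0). *)
Lemma exp_weighted_max_slope {R : realType} (f w : R -> R) (q a K u0 : R) :
  0 < q -> t^-1 * (f t - q) @[t --> 0^'+] --> a ->
  t^-1 * (w t - u0) @[t --> 0^'+] --> q ->
  0 <= K ->
  (\forall t \near 0^'+, f t * expR (K * w t) <= q * expR (K * u0)) ->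
  a + K * q ^+ 2 <= 0.
Proof.
move=> q0 fa wq K0 fw.
have fq : f t @[t --> 0^'+] --> q.
  have : t * (t^-1 * (f t - q)) + q @[t --> 0^'+] --> (0 : R) * a + q.
    apply: cvgD; last exact: cvg_cst.
    by apply: cvgM => //; apply: cvg_at_right_filter; exact: cvg_id.
  rewrite mul0r add0r; apply: cvg_trans; apply: near_eq_cvg.
  near=> t; rewrite mulrA divff ?mul1r ?subrK//.
have : t^-1 * (f t - q) + f t * (K * (t^-1 * (w t - u0))) @[t --> 0^'+]
    --> a + q * (K * q).
  by apply: cvgD => //; apply: cvgM => //; apply: cvgM => //; exact: cvg_cst.
rewrite expr2 (mulrCA q) => H.
apply: cvgr_to_le H _.
have f0 : \forall t \near 0^'+, 0 < f t by apply: cvgr_gt fq _ _.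
near=> t.
have t0 : 0 < t by near: t; exact: nbhs_right_gt.
have ft0 : 0 < f t by near: t.
have : f t * expR (K * w t) <= q * expR (K * u0) by near: t.
rewrite -ler_pdivrMr ?expR_gt0// -mulrA -expRN -expRD -mulrBr => fe.
(* The inequality [1 + x <= expR x] linearizes the weight, so the exponential never has to be
   differentiated. *)
have : f t * (1 + K * (w t - u0)) <= q.
  by apply: le_trans fe; rewrite ler_pM2l// expR_ge1Dx.
rewrite -subr_le0 => fq0.
have -> : t^-1 * (f t - q) + f t * (K * (t^-1 * (w t - u0))) =
  t^-1 * (f t * (1 + K * (w t - u0)) - q) by ring.
by rewrite pmulr_rle0 ?invr_gt0.
Unshelve. all: by end_near. Qed.

(** * Local geometry of the boundary *)

Section Boundary.
Context {R : realType} {n : nat}.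
Implicit Types (a h l v w x y z e : 'rV[R]_n) (A W : set 'rV[R]_n).

Lemma derivs2_continuous U (rho : 'rV[R]_n -> R) Drho D2rho x :
  derivs2 U rho Drho D2rho -> U x ->
  {for x, continuous rho} /\ {for x, continuous Drho}.
Proof.
move=> D Ux; have [[rd _] [Dd _]] := D _ Ux.
by split; exact: differentiable_continuous.
Qed.

Lemma boundary_notin W x : open W -> boundary W x -> ~ W x.
Proof. by move=> /interior_id oW []; rewrite oW. Qed.

(** A positive value would put [x] in the open set [W]; a negative one would persist nearby and keep
    [W] away from [x]. *)
Lemma C2_defining_boundary W (rho : 'rV[R]_n -> R) Drho U D2rho x :
  open W -> open U -> derivs2 U rho Drho D2rho ->
  (forall x, U x -> W x <-> 0 < rho x) -> U x ->
  boundary W x -> rho x = 0.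
Proof.
move=> oW oU D WU Ux bx.
have [rc _] := derivs2_continuous D Ux.
apply/eqP; rewrite eq_le; apply/andP; split.
  rewrite leNgt; apply/negP => /(WU _ Ux); exact: boundary_notin bx.
rewrite leNgt; apply/negP => rx.
have [clx _] := bx.
have N : nbhs x (U `&` [set y | rho y < 0]).
  apply: filterI; first exact: open_nbhs_nbhs.
  exact: cvgr_lt rc _ _.
have [y [Wy [Uy ry]]] := clx _ N.
by move: Wy => /(WU _ Uy) /lt_trans /(_ ry); rewrite ltxx.
Qed.

Lemma dot_slope (f : 'rV[R]_n -> 'rV[R]_n) x0 e : {for x0, continuous f} ->
  0 < dot (f x0) e -> \forall y \near x0, dot (f x0) e / 2 <= dot (f y) e.
Proof.
move=> fc fe.
have H : dot (f y) e @[y --> x0] --> dot (f x0) e.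
  exact: (@cvg_dot _ _ _ _ _ f (cst e) _ _ fc (cvg_cst e)).
apply: (cvgr_ge _ H).
by rewrite ltr_pdivrMr// ltr_pMr// ltr1n.
Qed.

Lemma near_norm x0 (P : set 'rV[R]_n) : (\forall y \near x0, P y) ->
  exists2 d : R, 0 < d & forall y, `|y - x0| < d -> P y.
Proof.
move=> /nbhs_ballP[d d0 H]; exists d => // y yd.
by apply: H; rewrite -ball_normE /= distrC.
Qed.

Lemma unit_direction v : v != 0 -> exists2 e, `|e| = 1 & 0 < dot v e.
Proof.
move=> v0; exists (`|v|^-1 *: v).
  by rewrite normrZ normfV normr_id mulVf ?normr_eq0.
by rewrite dotZr mulr_gt0 ?invr_gt0 ?normr_gt0 ?dot_gt0.
Qed.

Lemma mean_value_near (f : 'rV[R]_n -> R) (df : 'rV[R]_n -> 'rV[R]_n) x0 d a h :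
  (forall y, `|y - x0| < d -> is_diff y f (fun v => dot (df y) v)) ->
  (forall t : R, 0 <= t <= 1 -> `|a + t *: h - x0| < d) ->
  exists2 t : R, 0 < t < 1 & f (a + h) - f a = dot (df (a + t *: h)) h.
Proof.
move=> fd ad.
apply: (@mean_value_segment _ _ [set y | `|y - x0| < d]) => //.
- by move=> t /andP[t0 t1]; apply: fd; apply: ad; rewrite !ltW.
- apply/subspace_continuousP => y yd; apply: cvg_within_filter.
  by have [fy _] := fd _ yd; exact: differentiable_continuous.
Qed.

Lemma dot_dist_le v w h (e : R) : `|v - w| <= e -> `|dot v h - dot w h| <= n%:R * e * `|h|.
Proof.
move=> vw; rewrite -dotBl; apply: le_trans (abs_dot_le _ _) _.
by rewrite ler_wpM2r// ler_wpM2l.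
Qed.

(* The mean value theorem is applied along the path from x0 to x0 + s e, then to
   x + s e, then to x, with s = |x - x0| and e pointing inwards: up to its end
   points it lies in W, and its length is comparable to |x - x0|. *)
Lemma boundary_rel_diff W x0 (rho : 'rV[R]_n -> R) Drho (g : 'rV[R]_n -> R) dg :
  open W -> boundary W x0 -> C2_defining W x0 rho Drho ->
  (forall x, W x -> is_diff x g (fun h => dot (dg x) h)) ->
  {within closure W, continuous g} -> {within closure W, continuous dg} ->
  rel_diff (boundary W) x0 g (dg x0).
Proof.
move=> oW bx0 [U [D2rho [[oU Ux0] D _ D0 WU]]] gd gc dgc eps eps0.
have [e e1 De] := unit_direction (D0 _ Ux0).
have [_ Drc] := derivs2_continuous D Ux0.
set c := dot (Drho x0) e / 2 in De *.
have c0 : 0 < c by rewrite divr_gt0.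
(* Oscillation allowed for [Drho]: [2 n eta < c] keeps the error along [x - x0] below the gain along
   [e]. *)
pose eta := c / (4 * n%:R + 1).
have eta0 : 0 < eta by rewrite divr_gt0// ltr_wpDl// mulr_ge0.
have etaE : n%:R * eta * 2 < c.
  rewrite /eta; have N0 : 0 <= n%:R :> R by [].
  have := mulr_ge0 N0 (ltW c0); move: (n%:R : R) N0 => N N0 Nc.
  have -> : N * (c / (4 * N + 1)) * 2 = (2 * N * c) / (4 * N + 1) by ring.
  rewrite ltr_pdivrMr; last lra.
  by nra.
(* Each of the three segments of the path will contribute an error [n ep s]. *)
pose ep := eps / (3 * n%:R + 1).
have ep0 : 0 < ep by rewrite divr_gt0// ltr_wpDl// mulr_ge0.
have epE : 3 * (n%:R * ep) <= eps.
  rewrite /ep; have N0 : 0 <= n%:R :> R by [].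
  have := mulr_ge0 N0 (ltW eps0); move: (n%:R : R) N0 => N N0 Nc.
  have -> : 3 * (N * (eps / (3 * N + 1))) = (3 * N * eps) / (3 * N + 1) by ring.
  rewrite ler_pdivrMr; last lra.
  by nra.
have /near_norm[d d0 near_d] : \forall y \near x0, [/\ U y, c <= dot (Drho y) e,
    `|Drho x0 - Drho y| <= eta & closure W y -> `|dg x0 - dg y| <= ep].
  near=> y; split; near: y.
  - exact: open_nbhs_nbhs.
  - exact: dot_slope.
  - exact: cvgr_dist_le.
  - have /subspace_continuousP/(_ _ bx0.1) := dgc.
    by move=> /cvgrPdist_le /(_ _ ep0).
have rd y : `|y - x0| < d -> is_diff y rho (fun v => dot (Drho y) v).
  by move=> /near_d[Uy _ _ _]; have [] := D _ Uy.
have bd y : `|y - x0| < d -> boundary W y -> rho y = 0.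
  by move=> /near_d[Uy _ _ _]; exact: (C2_defining_boundary oW oU D WU Uy).
have x0d : `|x0 - x0| < d by rewrite subrr normr0.
near=> x => bx.
have sd : `|x - x0| < d / 3 by near: x; apply: cvgr_distC_lt => //; rewrite divr_gt0.
set s := `|x - x0| in sd *.
have xd : `|x - x0| < d by rewrite (lt_trans sd)// ltr_pdivrMr// ltr_pMr// ltr1n.
have [s0|s0] := eqVneq s 0.
  have xx0 : x = x0 by apply/eqP; rewrite -subr_eq0 -normr_eq0 -/s s0.
  by rewrite s0 xx0 !subrr dotC dot0l subr0 normr0 mulr0.
have {}s0 : 0 < s by rewrite lt_def s0 /s /=.
have vertd y t : y = x0 \/ y = x -> 0 <= t <= 1 -> `|y + t *: (s *: e) - x0| < d.
  move=> yx /andP[t0 t1].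
  have : `|y - x0| <= s.
    by case: yx => ->; [rewrite subrr normr0 ltW|exact: lexx].
  rewrite addrAC => ys; apply: le_lt_trans (ler_normD _ _) _.
  rewrite !normrZ e1 mulr1 !ger0_norm ?(ltW s0)//.
  have : t * s <= s by rewrite ler_piMl ?(ltW s0).
  by move: sd; rewrite ltr_pdivlMr//; lra.
have horid t : 0 <= t <= 1 -> `|(x0 + s *: e) + t *: (x - x0) - x0| < d.
  move=> /andP[t0 t1].
  rewrite -(addrA x0) addrAC subrr add0r.
  apply: le_lt_trans (ler_normD _ _) _.
  rewrite !normrZ e1 mulr1 !ger0_norm ?(ltW s0)//.
  have : t * s <= s by rewrite ler_piMl ?(ltW s0).
  by move: sd; rewrite ltr_pdivlMr// -/s; lra.
(* [rho] vanishes at [y] and grows with slope at least [c] along [e]; [t = 0] is excluded because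
   [y] itself is on the boundary. *)
have vertW y t : y = x0 \/ y = x -> 0 < t <= 1 -> W (y + t *: (s *: e)).
  move=> yx /andP[t0 t1].
  have yd : `|y - x0| < d by case: yx => ->.
  have b0 : rho y = 0 by case: yx => ->; exact: bd.
  have td r : 0 <= r <= 1 -> `|y + r *: (t *: (s *: e)) - x0| < d.
    move=> /andP[r0 r1]; rewrite scalerA; apply: vertd => //.
    by rewrite mulr_ge0 ?(ltW t0)//= mulr_ile1// ltW.
  have [r /andP[r0 r1]] := mean_value_near rd td.
  rewrite b0 subr0 !dotZr => rE.
  have [|Uy _ _ _] := near_d (y + t *: (s *: e)); first by apply: vertd => //; rewrite ltW.
  apply/(WU _ Uy); rewrite rE mulr_gt0// mulr_gt0//.
  have [|_ + _ _] := near_d (y + r *: (t *: (s *: e))); first by apply: td; rewrite !ltW.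
  exact: lt_le_trans.
have horiW t : 0 <= t <= 1 -> W ((x0 + s *: e) + t *: (x - x0)).
  move=> t01; have /andP[t0 t1] := t01.
  have [Uy _ _ _] := near_d _ (horid _ t01); apply/(WU _ Uy).
  have hd r : 0 <= r <= 1 -> `|x0 + r *: (s *: e + t *: (x - x0)) - x0| < d.
    move=> /andP[r0 r1]; rewrite addrAC subrr add0r normrZ ger0_norm//.
    apply: le_lt_trans (_ : `|s *: e + t *: (x - x0)| < d).
      by rewrite ler_piMl.
    by have := horid _ t01; rewrite -(addrA x0) addrAC subrr add0r.
  have [r /andP[r0 r1]] := mean_value_near rd hd.
  rewrite addrA (bd x0)// subr0 => ->.
  have [|_ De' De'' _] := near_d (x0 + r *: (s *: e + t *: (x - x0))).
    by apply: hd; rewrite !ltW.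
  (* As [rho] vanishes at both [x0] and [x], some [Drho] on the segment between them is orthogonal
     to [x - x0]. Any other nearby [Drho] differs from it by at most [2 eta], so the term in
     [x - x0] is smaller than [c s]. *)
  have xxd q : 0 <= q <= 1 -> `|x0 + q *: (x - x0) - x0| < d.
    move=> /andP[q0 q1]; rewrite addrAC subrr add0r normrZ ger0_norm//.
    by apply: le_lt_trans xd; rewrite ler_piMl.
  have [q /andP[q0 q1]] := mean_value_near rd xxd.
  have [|_ _ Dq _] := near_d (x0 + q *: (x - x0)); first by apply: xxd; rewrite !ltW.
  rewrite [x0 + (x - x0)]addrC subrK !bd// subrr => qE.
  rewrite dotDr !dotZr.
  have := dot_dist_le (x - x0) De''; have := dot_dist_le (x - x0) Dq.
  rewrite -qE subr0 -/s => H1 H2.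
  have H3 : `|dot (Drho (x0 + r *: (s *: e + t *: (x - x0)))) (x - x0)| <= n%:R * eta * 2 * s.
    move: H1 H2; rewrite !ler_norml => /andP[? ?] /andP[? ?]; apply/andP; split; lra.
  have H4 : n%:R * eta * 2 * s < c * s by rewrite ltr_pM2r.
  have H5 : c * s <= s * dot (Drho (x0 + r *: (s *: e + t *: (x - x0)))) e.
    by rewrite mulrC ler_pM2l.
  move: H3; set z := dot _ (x - x0) => H3.
  have : `|t * z| <= `|z| by rewrite normrM ger0_norm// ler_piMl.
  by rewrite ler_norml => /andP[? ?]; lra.
have gvert y : y = x0 \/ y = x ->
    `|g (y + s *: e) - g y - dot (dg x0) (s *: e)| <= n%:R * ep * s.
  move=> yx.
  have [t t01|t /andP[t0 t1]|t /andP[t0 t1] ->] :=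
    @mean_value_segment _ _ (closure W) g dg y (s *: e) _ gc.
  - by apply: gd; apply: vertW => //; have /andP[-> /ltW] := t01.
  - have [->|tn0] := eqVneq t 0.
      by rewrite scale0r addr0; case: yx => ->; [exact: bx0.1|exact: bx.1].
    by apply: subset_closure; apply: vertW => //; rewrite lt_def tn0 t0.
  - have [|_ _ _ H] := near_d (y + t *: (s *: e)); first by apply: vertd => //; rewrite !ltW.
    have Hd : `|dg x0 - dg (y + t *: (s *: e))| <= ep.
      by apply: H; apply: subset_closure; apply: vertW => //; rewrite t0 ltW.
    have := dot_dist_le (s *: e) Hd.
    by rewrite distrC normrZ e1 mulr1 gtr0_norm.
have ghori : `|g (x + s *: e) - g (x0 + s *: e) - dot (dg x0) (x - x0)| <= n%:R * ep * s.
  have [t t01|t t01|t /andP[t0 t1]] :=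
    @mean_value_segment _ _ (closure W) g dg (x0 + s *: e) (x - x0) _ gc.
  - by apply: gd; apply: horiW; have /andP[/ltW -> /ltW] := t01.
  - exact/subset_closure/horiW.
  - have t01 : 0 <= t <= 1 by rewrite !ltW.
    rewrite addrAC [x0 + (x - x0)]addrC subrK => ->.
    have [_ _ _ H] := near_d _ (horid _ t01).
    have Hd := H (subset_closure (horiW _ t01)).
    by have := dot_dist_le (x - x0) Hd; rewrite distrC.
(* The two vertical segments are run in opposite directions, so their linear terms
   [dot (dg x0) (s *: e)] cancel. *)
have := gvert x0 (or_introl erefl); have := gvert x (or_intror erefl).
have : n%:R * ep * s * 3 <= eps * s.
  by rewrite mulrAC ler_pM2r// mulrC.
move: ghori; rewrite -/s !ler_norml => /andP[? ?] ? /andP[? ?] /andP[? ?].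
by apply/andP; split; lra.
Unshelve. all: by end_near. Qed.

End Boundary.

(** * Inner normal and tangential paths *)

Section Normal.
Context {R : realType} {n : nat}.
Implicit Types (a h l v w x y z e : 'rV[R]_n) (A W U : set 'rV[R]_n).

Lemma tangent_path_straight x h : tangent_path setT x (fun t => x + t *: h) h.
Proof.
split; first exact: nearW.
have H : h @[t --> (0 : R)^'+] --> h by exact: cvg_cst.
apply: cvg_trans H; apply: near_eq_cvg; near=> t.
by rewrite addrAC subrr add0r scalerA mulVf ?scale1r.
Unshelve. all: by end_near. Qed.

Lemma is_diff_slope (f : 'rV[R]_n -> R) l x h :
  is_diff x f (fun v => dot l v) ->
  t^-1 * (f (x + t *: h) - f x) @[t --> 0^'+] --> dot l h.
Proof.
by move=> /(is_diff_rel_diff setT) /rel_diff_path; apply; exact: tangent_path_straight.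
Qed.

Lemma is_diff_increasing (f : 'rV[R]_n -> R) l x h :
  is_diff x f (fun v => dot l v) -> 0 < dot l h ->
  \forall t \near 0^'+, f x < f (x + t *: h).
Proof.
move=> /is_diff_slope fd lh.
have : \forall t \near 0^'+, 0 < t^-1 * (f (x + t *: h) - f x).
  by apply: cvgr_gt (fd h) _ _.
apply: filterS2 (nbhs_right_gt 0) => t t0.
by rewrite pmulr_rgt0 ?invr_gt0// subr_gt0.
Qed.

Lemma near_straight U x h : open U -> U x -> \forall t \near 0^'+, U (x + t *: h).
Proof.
move=> oU Ux; have := tangent_path_cvg (tangent_path_straight x h).
by move=> /(_ U); apply; exact: open_nbhs_nbhs.
Qed.

(** Following the gradient from a zero of [rho] makes [rho] positive at once, so [W] comes
    arbitrarily close to [x]. *)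
Lemma C2_defining_zero_boundary W (rho : 'rV[R]_n -> R) Drho U D2rho x :
  open W -> open U -> derivs2 U rho Drho D2rho ->
  (forall x, U x -> Drho x != 0) ->
  (forall x, U x -> W x <-> 0 < rho x) -> U x ->
  rho x = 0 -> boundary W x.
Proof.
move=> oW oU D D0 WU Ux r0; split; last first.
  by move/interior_id : oW => -> /(WU _ Ux); rewrite r0 ltxx.
have [rd _] := D _ Ux.
move=> V Vx.
have XV : \forall t \near 0^'+, V (x + t *: Drho x).
  exact: (tangent_path_cvg (tangent_path_straight x (Drho x)) Vx).
have inc := is_diff_increasing rd (dot_gt0 (D0 _ Ux)).
have [t [Vt [Ut /=]]] := filter_ex (filterI XV (filterI (near_straight (Drho x) oU Ux) inc)).
rewrite r0 => rt; exists (x + t *: Drho x); split => //.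
exact/(WU _ Ut).
Qed.

(* W contains the points x + t h for small t > 0 as soon as h points inwards for
   one of the defining functions. *)
Lemma C2_defining_halfspace W x (rho1 rho2 : 'rV[R]_n -> R) Drho1 Drho2 h :
  open W -> boundary W x ->
  C2_defining W x rho1 Drho1 -> C2_defining W x rho2 Drho2 ->
  0 < dot (Drho1 x) h -> 0 <= dot (Drho2 x) h.
Proof.
move=> oW bx [U1 [D1 [[oU1 Ux1] d1 _ _ WU1]]] [U2 [D2 [[oU2 Ux2] d2 _ _ WU2]]] h0.
have [rd1 _] := d1 _ Ux1; have [rd2 _] := d2 _ Ux2.
apply: cvgr_to_ge (is_diff_slope (h := h) rd2) _.
have inc := is_diff_increasing rd1 h0.
have r1 := C2_defining_boundary oW oU1 d1 WU1 Ux1 bx.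
have r2 := C2_defining_boundary oW oU2 d2 WU2 Ux2 bx.
near=> t; rewrite r2 subr0 mulr_ge0 ?invr_ge0//.
have U1t : U1 (x + t *: h) by near: t; exact: near_straight.
have U2t : U2 (x + t *: h) by near: t; exact: near_straight.
apply/ltW/(WU2 _ U2t)/(WU1 _ U1t); rewrite -r1.
by near: t.
Unshelve. all: by end_near. Qed.

Lemma halfspace_parallel v w : v != 0 -> w != 0 ->
  (forall h, 0 < dot v h -> 0 <= dot w h) ->
  (enorm v)^-1 *: v = (enorm w)^-1 *: w.
Proof.
move=> v0 w0 vw.
have vv := dot_gt0 v0.
(* The implication passes to the closed half-space by adding a small multiple of [v] to [h]. It then
   applies to [w - c *: v] and its opposite, both orthogonal to [v], which forces [w = c *: v]. *)
have vw0 h : 0 <= dot v h -> 0 <= dot w h.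
  move=> vh.
  rewrite leNgt; apply/negP => wh.
  have [e e0 He] : exists2 e : R, 0 < e & dot w h + e * dot w v < 0.
    have [p a0 qp] : exists2 p : R, 0 < 1 + p & dot w v <= p.
      by exists `|dot w v|; [rewrite ltr_pwDl|exact: ler_norm].
    (* With this [e], the term [e * dot w v] is at most half of [- dot w h], so the sum stays
       negative. *)
    exists (- dot w h / (1 + p) / 2); first by rewrite !divr_gt0 ?oppr_gt0.
    move: (dot w v) (dot w h) qp wh => q r qp r0.
    have : - r / (1 + p) / 2 * q <= - r / (1 + p) / 2 * (1 + p).
      by rewrite ler_wpM2l ?divr_ge0 ?oppr_ge0 ?ltW//; lra.
    have -> : - r / (1 + p) / 2 * (1 + p) = - r / 2 by field; rewrite lt0r_neq0.
    lra.
  have : 0 < dot v (h + e *: v) by rewrite dotDr dotZr ltr_wpDl// mulr_gt0.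
  by move=> /vw; rewrite dotDr dotZr leNgt He.
set c := dot w v / dot v v.
have wc : w = c *: v.
  apply/eqP; rewrite -subr_eq0; apply/eqP/dot_eq0.
  have ov : dot v (w - c *: v) = 0.
    by rewrite dotBr dotZr /c divfK ?lt0r_neq0// dotC subrr.
  have : dot w (w - c *: v) = 0.
    apply/eqP; rewrite eq_le; apply/andP; split; last by rewrite vw0// ov.
    by rewrite -oppr_ge0 -dotNr vw0// dotNr ov oppr0.
  by rewrite dotBl dotZl ov mulr0 subr0.
have c0 : 0 <= c by rewrite divr_ge0 ?vw0// ltW.
have {}c0 : 0 < c.
  rewrite lt_def c0 andbT; apply: contra w0 => /eqP c00.
  by rewrite wc c00 scale0r.
rewrite {2}wc scalerA wc enormZ ?(ltW c0)// invfM mulrAC mulVf ?mul1r//.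
by rewrite lt0r_neq0.
Qed.

(** The defining function picked by [xget] has a gradient positively parallel to that of [rho], both
    describing the same inward half-space. Stating this for every boundary point of [U] yields the
    normal on a whole neighbourhood, hence its continuity. *)
Lemma inner_normalE W x (rho : 'rV[R]_n -> R) Drho U D2rho :
  open W -> open U -> derivs2 U rho Drho D2rho -> {in U, continuous D2rho} ->
  (forall x, U x -> Drho x != 0) ->
  (forall x, U x -> W x <-> 0 < rho x) -> U x -> boundary W x ->
  inner_normal W x = (enorm (Drho x))^-1 *: Drho x.
Proof.
move=> oW oU D Dc D0 WU Ux bx.
have C : C2_defining W x rho Drho by exists U, D2rho.
rewrite /inner_normal; case: xgetP => [_ -> [rho' [Drho' [C' ->]]]|/(_ ((enorm (Drho x))^-1 *: Drho x))].
  apply: halfspace_parallel; last by move=> h; exact: C2_defining_halfspace C' C.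
    by case: C' => U' [D' [[oU' Ux'] _ _ D0' _]]; exact: D0'.
  exact: D0.
by case; exists rho, Drho.
Qed.

(* No implicit function theorem is needed: a zero of rho above x0 + t tau in the
   transversal direction e is found by the intermediate value theorem, at height
   at most |rho (x0 + t tau)| / c = o(t). *)
Lemma boundary_tangent_path W x0 (rho : 'rV[R]_n -> R) Drho tau :
  open W -> boundary W x0 -> C2_defining W x0 rho Drho ->
  dot (Drho x0) tau = 0 -> exists X, tangent_path (boundary W) x0 X tau.
Proof.
move=> oW bx0 [U [D2rho [[oU Ux0] D _ D0 WU]]] Dtau.
have [e e1 De] := unit_direction (D0 _ Ux0).
have [_ Drc] := derivs2_continuous D Ux0.
have r0 := C2_defining_boundary oW oU D WU Ux0 bx0.
set c := dot (Drho x0) e / 2 in De *.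
have c0 : 0 < c by rewrite divr_gt0.
have /near_norm[d d0 near_d] : \forall y \near x0, U y /\ c <= dot (Drho y) e.
  near=> y; split; near: y.
  - exact: open_nbhs_nbhs.
  - exact: dot_slope.
have rd y : `|y - x0| < d -> is_diff y rho (fun v => dot (Drho y) v).
  by move=> /near_d[Uy _]; have [] := D _ Uy.
pose P t := [set r : R | rho (x0 + t *: tau + r *: e) = 0 /\
  `|r| <= `|rho (x0 + t *: tau)| / c].
have [rd0 _] := D _ Ux0.
have kt := is_diff_slope (h := tau) rd0.
rewrite Dtau in kt.
have rt : rho (x0 + t *: tau) @[t --> 0^'+] --> rho x0.
  have := tangent_path_cvg (tangent_path_straight x0 tau).
  move=> H; apply: (continuous_cvg _ _ H).
  exact: differentiable_continuous.
have xt : x0 + t *: tau @[t --> 0^'+] --> x0.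
  exact: tangent_path_cvg (tangent_path_straight x0 tau).
have nP : \forall t \near 0^'+, P t !=set0.
  near=> t.
  set y := x0 + t *: tau.
  have yd : `|y - x0| < d / 2.
    by rewrite /y; near: t; apply: cvgr_distC_lt => //; rewrite divr_gt0.
  set k := rho y.
  have kd : `|k| < c * d / 2.
    rewrite /k /y -[rho _]subr0 -r0.
    by near: t; apply: cvgr_distC_lt => //; rewrite divr_gt0// mulr_gt0.
  have kcd : `|k| / c < d / 2 by rewrite ltr_pdivrMr// mulrC mulrA.
  have yrd r : `|r| <= `|k| / c -> `|y + r *: e - x0| < d.
    move=> rk; rewrite addrAC; apply: le_lt_trans (ler_normD _ _) _.
    rewrite normrZ e1 mulr1; lra.
  have fc (a b : R) : (forall r, a <= r <= b -> `|r| <= `|k| / c) ->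
      {within `[a, b], continuous (fun r => rho (y + r *: e))}.
    move=> ab; apply/subspace_continuousP => r; rewrite /= in_itv /= => rab.
    apply: cvg_within_filter.
    have seg := is_diff_segment y e r.
    have := is_diff_comp seg (rd _ (yrd _ (ab _ rab))).
    by move=> [+ _]; exact: differentiable_continuous.
  have rE r : `|r| <= `|k| / c -> exists2 D : R, c <= D & rho (y + r *: e) = k + r * D.
    move=> rk.
    have rh q : 0 <= q <= 1 -> `|y + q *: (r *: e) - x0| < d.
      move=> /andP[q0 q1]; rewrite scalerA; apply: yrd.
      by rewrite normrM ger0_norm//; apply: le_trans rk; rewrite ler_piMl.
    have [q /andP[q0 q1]] := mean_value_near rd rh.
    rewrite dotZr => E; exists (dot (Drho (y + q *: (r *: e))) e).
      by have [|] := near_d (y + q *: (r *: e)); first by apply: rh; rewrite !ltW.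
    by rewrite -E [RHS]addrC subrK.
  have nkc : `|- k / c| <= `|k| / c by rewrite normrM normrN (gtr0_norm (x := c^-1)) ?invr_gt0.
  (* At height [- k / c] a slope of at least [c] has overcome the initial value [k], so [rho] has
     changed sign or vanished there. The sign of [k] decides the order of the end points for the
     intermediate value theorem. *)
  have [D' cD' E'] := rE _ nkc.
  have D'0 : 1 <= D' / c by rewrite ler_pdivlMr// mul1r.
  have E'' : rho (y + (- k / c) *: e) = k * (1 - D' / c) by rewrite E'; ring.
  have [k0|k0] := leP 0 k.
  - have k'0 : - k / c <= 0 by rewrite mulNr oppr_le0 divr_ge0 // ltW.
    have [||r] := @IVT _ (fun r => rho (y + r *: e)) (- k / c) 0 0 k'0.
    + apply: fc => r /andP[r1 r2].
      by rewrite (ger0_norm k0) ler0_norm// lerNl -mulNr.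
    + rewrite E'' scale0r addr0 -/k ge_min le_max k0 orbT andbT.
      by rewrite mulr_ge0_le0// subr_le0.
    + rewrite in_itv /= => /andP[r1 r2] rr; exists r; split => //.
      by rewrite -/y -/k (ger0_norm k0) ler0_norm// lerNl -mulNr.
  - have k'0 : 0 <= - k / c by rewrite divr_ge0 ?oppr_ge0 // ltW.
    have [||r] := @IVT _ (fun r => rho (y + r *: e)) 0 (- k / c) 0 k'0.
    + apply: fc => r /andP[r1 r2].
      by rewrite (ltr0_norm k0) ger0_norm.
    + rewrite E'' scale0r addr0 -/k ge_min le_max (ltW k0) /=.
      by rewrite mulr_le0 ?orbT// ?subr_le0// ltW.
    + rewrite in_itv /= => /andP[r1 r2] rr; exists r; split => //.
      by rewrite -/y -/k (ltr0_norm k0) ger0_norm.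
(* The default 0 is taken only where [P t] is empty, which does not happen for small positive
   [t]. *)
pose r_ t := xget 0 (P t).
have Pr : \forall t \near 0^'+, P t (r_ t).
  by apply: filterS nP => t [r]; exact: xgetI.
(* The height is controlled by [rho (x0 + t *: tau)], whose slope at 0 is
   [dot (Drho x0) tau = 0]. *)
have r_t : t^-1 * r_ t @[t --> 0^'+] --> (0 : R).
  have kt0 : `|t^-1 * (rho (x0 + t *: tau) - rho x0)| / c @[t --> 0^'+] --> `|0 : R| / c.
    by apply: cvgMr_tmp; exact: cvg_norm.
  rewrite normr0 mul0r in kt0.
  apply/cvgr0Pnorm_le => eps eps0.
  move/cvgr0Pnorm_le : kt0 => /(_ _ eps0) kt0.
  apply: filterS2 Pr kt0 => t [_ rk].
  rewrite r0 subr0 ger0_norm; last by apply: divr_ge0 => //; exact: ltW.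
  by apply: le_trans; rewrite !normrM -mulrA ler_wpM2l.
exists (fun t => x0 + t *: tau + r_ t *: e); split.
  near=> t.
  have [rr rk] : P t (r_ t) by near: t.
  have rtd : `|x0 + t *: tau - x0| < d / 2.
    by near: t; apply: cvgr_distC_lt => //; rewrite divr_gt0.
  have kd : `|rho (x0 + t *: tau)| < c * d / 2.
    rewrite -[rho _]subr0 -r0.
    by near: t; apply: cvgr_distC_lt => //; rewrite divr_gt0// mulr_gt0.
  have kcd : `|rho (x0 + t *: tau)| / c < d / 2 by rewrite ltr_pdivrMr// mulrC mulrA.
  have [|Uy _] := near_d (x0 + t *: tau + r_ t *: e).
    rewrite addrAC; apply: le_lt_trans (ler_normD _ _) _.
    rewrite [`|r_ t *: e|]normrZ e1 mulr1; lra.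
  exact: C2_defining_zero_boundary oW oU D D0 WU Uy rr.
have : tau + (t^-1 * r_ t) *: e @[t --> 0^'+] --> tau + (0 : R) *: e.
  by apply: cvgD; [exact: cvg_cst|exact: cvgZr_tmp].
rewrite scale0r addr0; apply: cvg_trans; apply: near_eq_cvg; near=> t.
rewrite -(addrA x0) addrAC subrr add0r scalerDr !scalerA mulVf ?scale1r//.
Unshelve. all: by end_near. Qed.

End Normal.

(** * Null sets have no interior in the boundary *)

(** The least and greatest such indices differ by less than [2 * r / alpha]; the 1 counts both
    ends. *)
Lemma card_close {R : realType} N (alpha gamma r : R) : 0 < alpha -> 0 < r ->
  #|[pred l : 'I_N | `|alpha * l%:R - gamma| < r]|%:R <= 2 * r / alpha + 1.
Proof.
move=> al0 r0; set S := [pred l | _].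
have [/pred0P S0|/pred0Pn[i0 i0S]] := boolP (pred0b S).
  by rewrite eq_card0// addr_ge0// divr_ge0 ?mulr_ge0// ltW.
have [lo loS lomin] := arg_minnP (fun l : 'I_N => nat_of_ord l) i0S.
have [hi hiS himax] := arg_maxnP (fun l : 'I_N => nat_of_ord l) i0S.
have lohi : (lo <= hi)%N by exact: himax.
have Sle : (#|S| <= (hi - lo).+1)%N.
  rewrite -[X in (_ <= X)%N]card_ord.
  apply: (@leq_card_in _ _ (fun l : 'I_N => inord (l - lo) : 'I_(hi - lo).+1)).
  move=> l m lS mS /(congr1 (@nat_of_ord _)).
  have l1 : (lo <= l <= hi)%N by apply/andP; split; [exact: lomin|exact: himax].
  have m1 : (lo <= m <= hi)%N by apply/andP; split; [exact: lomin|exact: himax].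
  rewrite !inordK => [E||]; try lia.
  apply/val_inj => /=; lia.
apply: le_trans (_ : (hi - lo).+1%:R <= _); first by rewrite ler_nat.
rewrite -natr1 lerD2r ler_pdivlMr// natrB//.
move: loS hiS; rewrite /S !inE !ltr_norml => /andP[? ?] /andP[? ?].
lra.
Qed.


(* The boxes project to cubes of side 2 r k covering an (n-1)-dimensional cube of
   side a. A grid with N+1 points per direction, N large, has (N+1)^(n-1) points
   in the latter and at most (3 r k (N+1) / a)^(n-1) in each of the former. *)
Lemma slab_cover {R : realType} {n : nat} (i : 'I_n) (a : R) (x0 : 'rV[R]_n)
    (T : eqType) (I : seq T) (c : T -> 'rV[R]_n) (r : T -> R) :
  0 < a -> {in I, forall k, 0 < r k} ->
  (forall y, `|y - x0| <= a -> y 0 i = x0 0 i ->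
     exists2 k, k \in I & forall j, j != i -> `|y 0 j - c k 0 j| < r k) ->
  a ^+ n.-1 <= \sum_(k <- I) (3 * r k) ^+ n.-1.
Proof.
move=> a0 r0 cov.
(* The grid step [a / N.+1] must not exceed any [r k]; this absorbs the [+ 1] of [card_close] and
   turns the factor 2 into 3. *)
have [N HN] : exists N : nat, {in I, forall k, a <= r k * N.+1%:R}.
  elim: (I) r0 => [|k s IH] r0; first by exists 0%N.
  have [|N HN] := IH; first by move=> l ls; apply: r0; rewrite inE ls orbT.
  have rk : 0 < r k by rewrite r0// mem_head.
  have [M HM] : exists M : nat, a / r k < M%:R.
    by exists (Num.truncn (a / r k)).+1; rewrite truncnS_gt.
  exists (maxn N M) => l; rewrite inE => /orP[/eqP ->|ls].
    rewrite mulrC -ler_pdivrMr//; apply: le_trans (ltW HM) _.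
    by rewrite ler_nat leqW// leq_maxr.
  apply: le_trans (HN _ ls) _.
  rewrite ler_pM2l ?r0 ?inE ?ls ?orbT// ler_nat ltnS leq_maxl//.
have N0 : 0 < N.+1%:R :> R by [].
pose al := a / N.+1%:R; have al0 : 0 < al by rewrite divr_gt0.
(* Grid points are functions whose coordinate [i] is frozen at 0, which produces the exponent
   [n.-1]. *)
pose Fam (P : 'I_n -> pred 'I_N.+1) : pred {ffun 'I_n -> 'I_N.+1} :=
  family (fun j => if j == i then (pred1 ord0 : pred 'I_N.+1) else P j).
have cardFam P (B : R) : (forall j, #|P j|%:R <= B) -> #|Fam P|%:R <= B ^+ n.-1.
  move=> PB; rewrite /Fam card_family foldrE big_map -[X in X%:R]/(\prod_(j <- enum _) _)%N.
  rewrite big_enum /= (bigD1 i)//= eqxx card1 mul1n natr_prod.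
  have -> : B ^+ n.-1 = \prod_(j < n | j != i) B.
    rewrite prodr_const; congr (_ ^+ _).
    by rewrite -[n in LHS]card_ord -(cardC1 i).
  by apply: ler_prod => j ji; rewrite (negbTE ji) ler0n PB.
have cardT : #|Fam (fun=> predT)| = (N.+1 ^ n.-1)%N.
  rewrite /Fam card_family foldrE big_map -[LHS]/(\prod_(j <- enum _) _)%N.
  rewrite big_enum /= (bigD1 i)//= eqxx card1 mul1n.
  under eq_bigr => j ji do rewrite (negbTE ji) card_ord.
  rewrite prod_nat_const; congr (_ ^ _)%N.
  by rewrite -[n in RHS]card_ord -(cardC1 i).
pose P k j := [pred l : 'I_N.+1 | `|al * l%:R - (c k 0 j - x0 0 j)| < r k].
(* Double counting: every grid point lies in the projection of at least one box. *)
have cardG : (#|Fam (fun=> predT)| <= \sum_(k <- I) #|Fam (P k)|)%N.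
  rewrite -sum1_card; under [X in (_ <= X)%N]eq_bigr do rewrite -sum1_card.
  rewrite (exchange_big_dep xpredT)//= [X in (X <= _)%N]big_mkcond /=.
  apply: leq_sum => f _; case: ifP => // fG.
  have fi : f i = ord0.
    by move/familyP : fG => /(_ i); rewrite eqxx inE => /eqP.
  pose y := \row_j (x0 0 j + al * (f j)%:R).
  have [||k kI yk] := cov y.
  - apply: norm_le_coord => [|j]; first exact: ltW.
    rewrite !mxE addrAC subrr add0r ger0_norm; last by rewrite mulr_ge0 // ltW.
    rewrite /al mulrAC ler_pdivrMr// ler_pM2l// ler_nat ltnW//.
  - by rewrite /y mxE fi mulr0 addr0.
  rewrite sum1_count -has_count; apply/hasP; exists k => //.
  apply/familyP => j; have [->|ji] := eqVneq j i; first by rewrite inE fi.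
  by rewrite inE; have := yk j ji; rewrite /y mxE opprB addrA (addrC (al * _)).
have : N.+1%:R ^+ n.-1 <= \sum_(k <- I) (3 * r k / al) ^+ n.-1.
  move: cardG; rewrite cardT -(ler_nat R) natrX natr_sum => /le_trans; apply.
  rewrite big_seq [leRHS]big_seq; apply: ler_sum => k kI.
  apply: cardFam => j; apply: le_trans (card_close _ _ al0 (r0 _ kI)) _.
  have : 1 <= r k / al.
    by rewrite ler_pdivlMr// mul1r /al ler_pdivrMr// HN.
  by rewrite -!mulrA; lra.
have aE : a = al * N.+1%:R by rewrite /al divfK// lt0r_neq0.
rewrite [in X in _ -> X]aE exprMn -(ler_pM2l (exprn_gt0 n.-1 al0)) => /le_trans; apply.
rewrite mulr_sumr; apply: ler_sum => k _.
by rewrite -exprMn mulrCA divff ?mulr1// lt0r_neq0.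
Qed.

(** Two covers of cost below [e / 2] are interleaved, the first on even indices and the second on
    odd ones. *)
Lemma hausdorff_nullU {R : realType} {n s : nat} (N1 N2 : set 'rV[R]_n) :
  hausdorff_null s N1 -> hausdorff_null s N2 -> hausdorff_null s (N1 `|` N2).
Proof.
move=> h1 h2 e d e0 d0; have e20 : 0 < e / 2 by rewrite divr_gt0.
have [I1 [c1 [r1 [r1d N1c H1]]]] := h1 _ _ e20 d0.
have [I2 [c2 [r2 [r2d N2c H2]]]] := h2 _ _ e20 d0.
pose J := [set k | if odd k then I2 k./2 else I1 k./2].
pose c k := if odd k then c2 k./2 else c1 k./2.
pose r k := if odd k then r2 k./2 else r1 k./2.
have rd k : J k -> 0 < r k < d.
  by rewrite /J /r /=; case: (odd k) => [/r2d|/r1d].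
exists J, c, r; split => //.
  move=> x [/N1c[k I1k kx]|/N2c[k I2k kx]].
    by exists k.*2; rewrite /J /c /r /= odd_double doubleK.
  by exists k.*2.+1; rewrite /J /c /r /= odd_double uphalf_double.
rewrite (esumID odd); last by move=> k Jk; rewrite lee_fin exprn_ge0// ltW//; have /andP[] := rd _ Jk.
have -> : \esum_(i in J `&` odd) (r i ^+ s)%:E = \esum_(i in I2) (r2 i ^+ s)%:E.
  rewrite (reindex_esum I2 _ (fun k => k.*2.+1)).
    by apply: eq_esum => k _; rewrite /r /= odd_double uphalf_double.
  split.
  - by move=> k; rewrite /J /= odd_double uphalf_double.
  - by move=> k l _ _ /= [] /double_inj.
  - move=> k [] /=; rewrite /J /= => + ok; rewrite ok => Ik; exists k./2 => //=.
    by rewrite -[RHS]odd_double_half ok.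
have -> : \esum_(i in J `&` ~` odd) (r i ^+ s)%:E = \esum_(i in I1) (r1 i ^+ s)%:E.
  rewrite (reindex_esum I1 _ (fun k => k.*2)).
    by apply: eq_esum => k _; rewrite /r /= odd_double doubleK.
  split.
  - by move=> k; rewrite /J /= odd_double doubleK.
  - by move=> k l _ _ /= /double_inj.
  - move=> k [] /=; rewrite /J /= => + /negP ok; rewrite (negbTE ok) => Ik; exists k./2 => //=.
    by rewrite -[RHS]odd_double_half (negbTE ok).
by rewrite [e]splitr EFinD lteD.
Qed.

Section Dense.
Context {R : realType} {n : nat}.
Implicit Types (x y z e : 'rV[R]_n) (W V N : set 'rV[R]_n).

Lemma closed_boundary W : closed (boundary W).
Proof.
rewrite /boundary setDE; apply: closedI; first exact: closed_closure.
by apply: open_closedC; exact: open_interior.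
Qed.

Lemma bounded_set_closure W : bounded_set W -> bounded_set (closure W).
Proof.
move=> [M [Mr WM]]; exists M; split => // M' MM' x clx /=.
rewrite leNgt; apply/negP => xM.
have [y [Wy /=]] := clx _ (cvgr_gt _ (@norm_continuous R _ x) _ xM).
by rewrite ltNge (WM _ MM').
Qed.

Lemma compact_closure W : bounded_set W -> compact (closure W).
Proof.
move=> bW; apply: bounded_closed_compact; last exact: closed_closure.
exact: bounded_set_closure.
Qed.

Lemma compact_boundary W : bounded_set W -> compact (boundary W).
Proof.
move=> bW; apply: subclosed_compact (compact_closure bW) _; first exact: closed_boundary.
by move=> x [].
Qed.

Lemma eball_open x (r : R) : open (eball x r).
Proof.
rewrite openE => y yr; rewrite /interior.
have H : z - x @[z --> y] --> y - x.
  exact: (@cvgB R _ _ (nbhs y) _ id (cst x) y x cvg_id (cvg_cst x)).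
exact: cvgr_lt (cvg_enorm H) _ yr.
Qed.

(** Here, unlike in [unit_direction], moving along [e] changes a single coordinate, so the
    projection along axis [i] is unaffected. *)
Lemma coord_direction v : v != 0 ->
  exists (i : 'I_n) (e : 'rV[R]_n), [/\ `|e| <= 1, 0 < dot v e & forall j, j != i -> e 0 j = 0].
Proof.
move=> v0; have [i vi] : exists i, v 0 i != 0.
  apply/existsP; apply: contraNT v0 => /existsPn v0.
  by apply/eqP/rowP => i; rewrite mxE; have := v0 i; rewrite negbK => /eqP.
exists i, (\row_j if j == i then Num.sg (v 0 i) else 0); split.
- apply: norm_le_coord => // j; rewrite mxE; case: ifP => _; last by rewrite normr0.
  by rewrite normr_sg vi.
- rewrite /dot (bigD1 i)//= big1 => [|j ji]; last by rewrite mxE (negbTE ji) mulr0.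
  by rewrite mxE eqxx addr0 mulrC -normrEsg normr_gt0.
- by move=> j ji; rewrite mxE (negbTE ji).
Qed.

(* Near x0 the boundary projects along some coordinate axis onto a set containing
   an (n-1)-dimensional cube, which [slab_cover] prevents from being null. *)
Lemma boundary_not_null W x0 V N (rho : 'rV[R]_n -> R) Drho :
  open W -> bounded_set W -> boundary W x0 -> C2_defining W x0 rho Drho ->
  nbhs x0 V -> hausdorff_null n.-1 N -> exists x, [/\ boundary W x, V x & ~ N x].
Proof.
move=> oW bW bx0 [U [D2rho [[oU Ux0] D _ D0 WU]]] Vx0 N0.
apply: contrapT => H.
have {}H x : boundary W x -> V x -> N x.
  by move=> bx Vx; apply: contrapT => Nx; apply: H; exists x.
have [i [e [e1 De ei]]] := coord_direction (D0 _ Ux0).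
have [_ Drc] := derivs2_continuous D Ux0.
have r0 := C2_defining_boundary oW oU D WU Ux0 bx0.
set c := dot (Drho x0) e / 2 in De *.
have c0 : 0 < c by rewrite divr_gt0.
pose M := `|Drho x0| + 1.
have M0 : 0 < M by rewrite ltr_wpDl.
have /near_norm[d d0 near_d] : \forall y \near x0,
    [/\ U y, V y, c <= dot (Drho y) e & `|Drho y| <= M].
  near=> y; split; near: y.
  - exact: open_nbhs_nbhs.
  - exact: Vx0.
  - exact: dot_slope.
  - by apply: (cvgr_norm_le _ Drc); rewrite ltrDl.
have rd y : `|y - x0| < d -> is_diff y rho (fun v => dot (Drho y) v).
  by move=> /near_d[Uy _ _ _]; have [] := D _ Uy.
have [a a0 ad] : exists2 a : R, 0 < a & a + a < d.
  by exists (d / 3); lra.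
(* Over the smaller cube of half-side [a'], [rho] varies by at most [n M a'], which the gain [c a]
   along [e] compensates. *)
have [a' [a'0 a'a a'M]] : exists a' : R, [/\ 0 < a', a' <= a & n%:R * M * a' <= c * a].
  have nM0 : 0 < n%:R * M + 1 by rewrite ltr_wpDl// mulr_ge0// ltW.
  exists (Num.min a (c * a / (n%:R * M + 1))); split.
  - by rewrite lt_min a0 divr_gt0// mulr_gt0.
  - by rewrite ge_min lexx.
  have : Num.min a (c * a / (n%:R * M + 1)) <= c * a / (n%:R * M + 1).
    by rewrite ge_min lexx orbT.
  have : 0 <= Num.min a (c * a / (n%:R * M + 1)).
    rewrite le_min (ltW a0); apply: divr_ge0; last exact: ltW.
    by apply: mulr_ge0; exact: ltW.
  rewrite ler_pdivlMr//; lra.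
have yrd y (r : R) : `|y - x0| <= a' -> `|r| <= a -> `|y + r *: e - x0| <= a + a.
  move=> ya ra; rewrite addrAC; apply: le_trans (ler_normD _ _) _.
  apply: lerD; first exact: le_trans a'a.
  by rewrite normrZ -[a]mulr1 ler_pM.
have lift y : `|y - x0| <= a' -> exists2 r : R, `|r| <= a & rho (y + r *: e) = 0.
  move=> ya.
  (* For [s = 1] and [s = -1] this gives the signs of [rho] at heights [a] and [- a], between which
     a zero lies. *)
  have val (s : R) : `|s| = 1 -> 0 <= s * rho (y + (s * a) *: e).
    move=> s1.
    have sa : `|s * a| <= a by rewrite normrM s1 mul1r gtr0_norm.
    have hd t : 0 <= t <= 1 -> `|x0 + t *: (y + (s * a) *: e - x0) - x0| < d.
      move=> /andP[t0 t1]; rewrite addrAC subrr add0r normrZ ger0_norm//.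
      apply: le_lt_trans (_ : `|y + (s * a) *: e - x0| < d); first by rewrite ler_piMl.
      by apply: le_lt_trans ad; exact: yrd.
    have [t /andP[t0 t1]] := mean_value_near rd hd.
    rewrite [x0 + (_ - x0)]addrC subrK r0 subr0 => ->.
    have [|_ _ De' M'] := near_d (x0 + t *: (y + (s * a) *: e - x0)).
      by apply: hd; rewrite !ltW.
    move: De' M'; set v := Drho _ => De' M'.
    have ss : s * s = 1 by rewrite -expr2 -real_normK ?num_real// s1 expr1n.
    rewrite addrAC dotDr dotZr mulrDr !mulrA ss mul1r.
    have h1 : `|s * dot v (y - x0)| <= c * a.
      rewrite normrM s1 mul1r; apply: le_trans (abs_dot_le _ _) _.
      by apply: le_trans a'M; rewrite -!mulrA ler_wpM2l// ler_pM.
    have h2 : c * a <= a * dot v e by rewrite mulrC ler_pM2l.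
    move: h1; rewrite ler_norml => /andP[? ?]; lra.
  have [|||r] := @IVT _ (fun r => rho (y + r *: e)) (- a) a 0.
  - lra.
  - apply/subspace_continuousP => r; rewrite /= in_itv /= -ler_norml => ra.
    apply: cvg_within_filter.
    have seg := is_diff_segment y e r.
    have rd' := rd _ (le_lt_trans (yrd _ _ ya ra) ad).
    have := is_diff_comp seg rd'.
    by move=> [+ _]; exact: differentiable_continuous.
  - have := val 1 (normr1 _); have := val (-1) (normrN1 _).
    rewrite !mul1r !mulN1r oppr_ge0 => h1 h2.
    by rewrite ge_min le_max h1 h2 orbT.
  - by rewrite in_itv /= -ler_norml => ra rr; exists r.
(* Compactness of this piece extracts a finite subcover, as [slab_cover] requires. *)
pose K := boundary W `&` closed_ball x0 (a + a).
have aa0 : 0 < a + a by rewrite addr_gt0.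
have KV x : K x -> N x.
  rewrite /K closed_ballE// => -[bx xa]; apply: H => //.
  have {}xa : `|x - x0| <= a + a by rewrite distrC.
  by have [] := near_d x (le_lt_trans xa ad).
have cK : compact K.
  apply: compact_closedI; last exact: closed_ball_closed.
  exact: compact_boundary.
pose eps := (a' / 3) ^+ n.-1.
have eps0 : 0 < eps by rewrite exprn_gt0// divr_gt0.
have [I [cc [rr [rrd Nc Hsum]]]] := N0 _ _ eps0 ltr01.
have [F FI KF] : finite_subset_cover I (fun k => eball (cc k) (rr k)) K.
  move: cK; rewrite compact_cover; apply => [k _|x Kx]; first exact: eball_open.
  exact: Nc (KV _ Kx).
have Fr : {in finmap.enum_fset F, forall k, 0 < rr k}.
  by move=> k kF; have := FI k kF; rewrite inE => /rrd/andP[].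
have cov y : `|y - x0| <= a' -> y 0 i = x0 0 i ->
    exists2 k, k \in finmap.enum_fset F & forall j, j != i -> `|y 0 j - cc k 0 j| < rr k.
  move=> ya yi; have [r ra rr0] := lift _ ya.
  have yr := yrd _ _ ya ra.
  have [Uy _ _ _] := near_d _ (le_lt_trans yr ad).
  have Ky : K (y + r *: e).
    split; first exact: C2_defining_zero_boundary oW oU D D0 WU Uy rr0.
    by rewrite closed_ballE// /closed_ball_ /= distrC.
  have [k kF yk] := KF _ Ky.
  (* Off coordinate [i] the lifted point agrees with [y], and a Euclidean ball projects into a box
     of the same radius. *)
  exists k => // j ji; apply: le_lt_trans yk.
  have := coord_le_enorm (y + r *: e - cc k) j.
  by rewrite !mxE ei// mulr0 addr0.
have := slab_cover a'0 Fr cov.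
apply/negP; rewrite -ltNge.
have : \sum_(k <- finmap.enum_fset F) rr k ^+ n.-1 < eps.
  rewrite -lte_fin; apply: le_lt_trans Hsum; apply: esum_ge.
  exists [set` finmap.enum_fset F].
    by split => // k /= kF; have := FI k kF; rewrite inE.
  by rewrite -fsbig_seq// sumEFin.
rewrite /eps expr_div_n ltr_pdivlMr ?exprn_gt0//; apply: le_lt_trans.
rewrite mulr_suml; apply: ler_sum => k _.
by rewrite exprMn mulrC.
Unshelve. all: by end_near. Qed.

End Dense.

(** * The gradient estimate *)

Section Estimates.
Context {R : realType} {n : nat}.
Implicit Types (x y z e v w tau : 'rV[R]_n) (A W V N : set 'rV[R]_n).

(** Passing from a maximum point of the weighted function to any [x] costs a factor
    [expR (K * (u c - u x))]. This serves for the tangential gradient on the boundary and for the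
    full gradient on the closure. *)
Lemma weighted_max A (G u : 'rV[R]_n -> R) (K M L : R) :
  compact A -> {within A, continuous G} -> {within A, continuous u} ->
  0 <= K -> 0 <= L -> (forall x, A x -> `|u x| <= M) ->
  (forall x0, A x0 -> (forall x, A x -> G x * expR (K * u x) <= G x0 * expR (K * u x0)) ->
     G x0 <= L) ->
  forall x, A x -> G x <= L * expR (2 * K * M).
Proof.
move=> cA Gc uc K0 L0 uM GL x Ax.
have [||c] := compact_EVT_max _ cA (f := fun x => G x * expR (K * u x)).
- by exists x.
- apply/subspace_continuousP => y Ay.
  move/subspace_continuousP : Gc => /(_ _ Ay) Gy.
  move/subspace_continuousP : uc => /(_ _ Ay) uy.
  apply: (@cvgM R) => //.
  apply: continuous_cvg; first exact: continuous_expR.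
  exact: cvgMl_tmp.
rewrite inE => Ac Gmax.
have {}Gmax y : A y -> G y * expR (K * u y) <= G c * expR (K * u c).
  by move=> Ay; apply: Gmax; rewrite inE.
have Gc' := GL _ Ac Gmax.
have := Gmax _ Ax; rewrite -ler_pdivlMr ?expR_gt0// => /le_trans; apply.
rewrite -(mulrA (G c)) -expRN -expRD.
apply: le_trans (_ : L * expR (K * u c - K * u x) <= _).
  by rewrite ler_wpM2r ?expR_ge0.
rewrite ler_wpM2l// ler_expR.
have ucx : u c - u x <= 2 * M.
  have := uM _ Ac; have := uM _ Ax; rewrite !ler_norml => /andP[? ?] /andP[? ?].
  lra.
by have := ler_wpM2l K0 ucx; lra.
Qed.

Lemma closure_le W (f : 'rV[R]_n -> R) (b : R) x :
  {within closure W, continuous f} -> (forall y, W y -> b <= f y) -> closure W x -> b <= f x.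
Proof.
move=> /subspace_continuousP fc fb clx.
have := fc _ clx.
rewrite leNgt => H; apply/negP => fxb.
have N : \forall y \near within (closure W) (nbhs x), f y < b by apply: (cvgr_lt _ H).
have [y [Wy Hy]] := clx _ N.
have := Hy (subset_closure Wy).
by rewrite ltNge fb.
Qed.

End Estimates.

(** * Continuity of the normal and uniform curvature bound *)

Section InnerNormal.
Context {R : realType} {n : nat}.
Implicit Types (x y z e v w tau : 'rV[R]_n) (A W V N U : set 'rV[R]_n).

Lemma C2_domain_defining W x0 : bounded_C2_domain W -> boundary W x0 ->
  exists rho Drho, C2_defining W x0 rho Drho.
Proof. by move=> [_ _ _ _ H]; exact: H. Qed.

Lemma inner_normal_near W x0 (rho : 'rV[R]_n -> R) Drho :
  open W -> C2_defining W x0 rho Drho ->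
  \forall y \near x0, boundary W y ->
    inner_normal W y = (enorm (Drho y))^-1 *: Drho y.
Proof.
move=> oW [U [D2rho [[oU Ux0] D Dc D0 WU]]].
apply: filterS (open_nbhs_nbhs (conj oU Ux0)) => y Uy.
exact: (inner_normalE oW oU D Dc D0 WU).
Qed.

Lemma C2_defining_gradient W x0 (rho : 'rV[R]_n -> R) Drho :
  C2_defining W x0 rho Drho -> {for x0, continuous Drho} /\ Drho x0 != 0.
Proof.
move=> [U [D2rho [[oU Ux0] D Dc D0 WU]]]; split; last exact: D0.
by have [] := derivs2_continuous D Ux0.
Qed.

Lemma enorm_inner_normal W x0 : bounded_C2_domain W -> boundary W x0 ->
  enorm (inner_normal W x0) = 1.
Proof.
move=> hW bx0; have [rho [Drho C]] := C2_domain_defining hW bx0.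
have [_ oW _ _ _] := hW.
rewrite (nbhs_singleton (inner_normal_near oW C))//.
by rewrite enorm_normalized//; have [] := C2_defining_gradient C.
Qed.

Lemma inner_normal_continuous W : bounded_C2_domain W ->
  {within boundary W, continuous (inner_normal W)}.
Proof.
move=> hW; apply/subspace_continuousP => x0 bx0.
have [rho [Drho C]] := C2_domain_defining hW bx0.
have [_ oW _ _ _] := hW.
have nE := inner_normal_near oW C.
have nE0 := nbhs_singleton nE bx0.
have [Dc D0] := C2_defining_gradient C.
have H : (enorm (Drho y))^-1 *: Drho y @[y --> within (boundary W) (nbhs x0)]
    --> (enorm (Drho x0))^-1 *: Drho x0.
  apply: cvg_within_filter; apply: cvgZ => //.
  apply: cvgV; first by rewrite lt0r_neq0// enorm_gt0.
  exact: cvg_enorm.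
rewrite -nE0 in H; apply: cvg_trans H; apply: near_eq_cvg.
rewrite /prop_near1 /within /=.
apply: filterS nE => y Hy bdy; exact: esym (Hy bdy).
Qed.

(** For tangential [tau] the bounded quotient is, up to sign, the normal curvature. A defining
    function bounds it near its own point, and compactness of the boundary makes the constant
    uniform. *)
Lemma uniform_curvature W : bounded_C2_domain W ->
  exists2 kappa : R, 0 <= kappa & forall x, boundary W x ->
    exists U rho Drho D2rho,
    [/\ C2_defining W x rho Drho, U x, open U, derivs2 U rho Drho D2rho &
     forall tau, enorm tau = 1 ->
       `|dot (tau *m D2rho x) tau| <= kappa * enorm (Drho x)].
Proof.
move=> hW; have [_ oW _ bW _] := hW.
have /compact_near_coveringP cov := compact_boundary bW.
pose P (kappa : R) x := exists U rho Drho D2rho,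
    [/\ C2_defining W x rho Drho, U x, open U, derivs2 U rho Drho D2rho &
     forall tau, enorm tau = 1 ->
       `|dot (tau *m D2rho x) tau| <= kappa * enorm (Drho x)].
have : \forall kappa \near +oo, boundary W `<=` P kappa.
  apply: cov => x bx.
  have [rho [Drho C]] := C2_domain_defining hW bx.
  have [Drc D0x] := C2_defining_gradient C.
  have [U [D2rho [[oU Ux] D Dc D0 WU]]] := C.
  have m0 := enorm_gt0 D0x.
  have NU : \forall y \near x, [/\ U y, `|D2rho y| <= `|D2rho x| + 1 &
      enorm (Drho x) / 2 <= enorm (Drho y)].
    near=> y; split; near: y.
    - exact: open_nbhs_nbhs.
    - have Dcx : {for x, continuous D2rho} by apply: Dc; rewrite inE.
      by apply: (cvgr_norm_le _ Dcx); rewrite ltrDl.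
    - apply: (cvgr_ge _ (cvg_enorm Drc)); lra.
  (* The numerator bounds the quadratic form of [D2rho] at unit vectors near [x], the denominator
     bounds the gradient from below. *)
  pose k0 := n%:R * n%:R * (`|D2rho x| + 1) / (enorm (Drho x) / 2).
  exists ([set y | [/\ U y, `|D2rho y| <= `|D2rho x| + 1 &
      enorm (Drho x) / 2 <= enorm (Drho y)]], [set k | k0 <= k]) => /=.
    by split; [exact: NU|apply: nbhs_pinfty_ge; exact: num_real].
  move=> [y k] /= [[Uy D2y Dy] k0k].
  exists U, rho, Drho, D2rho; split => //; first by exists U, D2rho.
  move=> tau tau1; apply: le_trans (abs_dot_le _ _) _.
  have t1 : `|tau| <= 1 by rewrite -tau1 norm_le_enorm.
  apply: le_trans (_ : n%:R * n%:R * (`|D2rho x| + 1) <= _).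
    rewrite -!mulrA ler_wpM2l//.
    apply: le_trans (_ : `|tau *m D2rho y| <= _); first exact: ler_piMr.
    apply: le_trans (mulmx_norm_le _ _) _.
    by rewrite -mulrA ler_wpM2l// -[leRHS]mul1r ler_pM.
  have -> : n%:R * n%:R * (`|D2rho x| + 1) = k0 * (enorm (Drho x) / 2).
    by rewrite /k0 divfK// lt0r_neq0// divr_gt0.
  have k00 : 0 <= k0.
    by rewrite /k0 divr_ge0// ?mulr_ge0 ?addr_ge0 ?divr_ge0// enorm_ge0.
  by apply: ler_pM => //; rewrite divr_ge0 ?enorm_ge0.
move=> H.
have [k [kP k0]] : exists k, boundary W `<=` P k /\ 0 <= k.
  have H2 : \forall k \near (+oo : set_system R), 0 <= k by exact: nbhs_pinfty_ge.
  by have [k []] := filter_ex (filterI H H2); exists k.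
by exists k.
Unshelve. all: by end_near. Qed.

End InnerNormal.

(** * Differential inequalities at maximum points *)

Section Final.
Context {R : realType} {n : nat}.
Implicit Types (x y z e v w tau : 'rV[R]_n) (A W V N U : set 'rV[R]_n).

Lemma boundary_aeI W (P Q : 'rV[R]_n -> Prop) :
  boundary_ae W P -> boundary_ae W Q -> boundary_ae W (fun x => P x /\ Q x).
Proof.
move=> [N1 [N10 N1P]] [N2 [N20 N2Q]]; exists (N1 `|` N2); split.
  exact: hausdorff_nullU.
by move=> x bx /not_orP[n1 n2]; split; [exact: N1P|exact: N2Q].
Qed.

(** A violation at one point persists on a relatively open piece of the boundary, which no null set
    can contain. *)
Lemma boundary_ae_le W (P : 'rV[R]_n -> Prop) (f g : 'rV[R]_n -> R) :
  bounded_C2_domain W ->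
  {within boundary W, continuous f} -> {within boundary W, continuous g} ->
  boundary_ae W P -> (forall x, boundary W x -> P x -> f x <= g x) ->
  forall x, boundary W x -> f x <= g x.
Proof.
move=> hW /subspace_continuousP fc /subspace_continuousP gc [N [N0 NP]] Pfg x bx.
have [_ oW _ bW _] := hW; have [rho [Drho C]] := C2_domain_defining hW bx.
rewrite leNgt; apply/negP; rewrite -subr_gt0 => fgx.
have H : \forall y \near within (boundary W) (nbhs x), 0 < f y - g y.
  by apply: (cvgr_gt _ (cvgB (fc _ bx) (gc _ bx))).
have [y [bdy + Ny]] := boundary_not_null oW bW bx C H N0.
by move=> /(_ bdy); rewrite subr_gt0 ltNge Pfg//; exact: NP.
Qed.

Lemma tang_continuous A (f g : 'rV[R]_n -> 'rV[R]_n) :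
  {within A, continuous f} -> {within A, continuous g} ->
  {within A, continuous (fun x => enorm (tang (f x) (g x)))}.
Proof.
move=> /subspace_continuousP fc /subspace_continuousP gc.
apply/subspace_continuousP => x Ax; apply: cvg_enorm.
apply: cvgB; first exact: fc.
by apply: cvgZ; [apply: cvg_dot; [exact: fc|exact: gc]|exact: gc].
Qed.

(** The field [beta] has disappeared from the conclusion, whose two sides are continuous on the
    boundary; this is what lets the inequality hold everywhere. *)
Lemma oblique_boundary W Du beta (sigma0 beta0 : R) :
  bounded_C2_domain W -> {within closure W, continuous Du} ->
  boundary_ae W (fun x => enorm (beta x) = 1) ->
  boundary_ae W (fun x => `|dot (beta x) (Du x)| <= sigma0) ->
  boundary_ae W (fun x => beta0 <= dot (beta x) (inner_normal W x)) ->
  forall x, boundary W x -> beta0 * `|dot (Du x) (inner_normal W x)| <=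
    sigma0 + enorm (tang (Du x) (inner_normal W x)).
Proof.
move=> hW Duc b1 bD bnu.
have nuc := inner_normal_continuous hW.
have bDuc : {within boundary W, continuous Du}.
  by apply: continuous_subspaceW Duc => x [].
apply: (boundary_ae_le hW _ _ (boundary_aeI b1 (boundary_aeI bD bnu))).
- apply/subspace_continuousP => x bx.
  apply: cvgMl_tmp; apply: cvg_norm; apply: cvg_dot.
    by move/subspace_continuousP : bDuc; exact.
  by move/subspace_continuousP : nuc; exact.
- apply/subspace_continuousP => x bx; apply: cvgD; first exact: cvg_cst.
  by move/subspace_continuousP : (tang_continuous bDuc nuc); exact.
move=> x bx [beta1 [betaD betanu]].
exact: oblique_normal (enorm_inner_normal hW bx) beta1 betaD betanu.
Qed.

(** The direction [tau] is frozen: [dot (tang (Du x) (nu x)) tau] is at most the norm of the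
    tangential gradient, with equality at [x0]. The maximum is thus inherited by an expression that
    is easier to differentiate along a tangent path. *)
Lemma tangential_critical W x0 u Du D2u (rho : 'rV[R]_n -> R) Drho D2rho U (K : R) :
  let nu := inner_normal W in
  let q := enorm (tang (Du x0) (nu x0)) in
  let tau := q^-1 *: tang (Du x0) (nu x0) in
  bounded_C2_domain W -> boundary W x0 -> C2_closure W u Du D2u ->
  C2_defining W x0 rho Drho -> U x0 -> derivs2 U rho Drho D2rho ->
  0 <= K -> 0 < q ->
  (forall x, boundary W x ->
     enorm (tang (Du x) (nu x)) * expR (K * u x) <= q * expR (K * u x0)) ->
  dot (tau *m D2u x0) tau -
    dot (Du x0) (nu x0) * (dot (tau *m D2rho x0) tau / enorm (Drho x0)) + K * q ^+ 2 <= 0.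
Proof.
move=> nu q tau hW bx0 [Dd uc Duc D2uc] C Ux0 D K0 q0 max0.
have [_ oW _ _ _] := hW.
have nu1 := enorm_inner_normal hW bx0.
have nuE := inner_normal_near oW C.
have [Drc D0] := C2_defining_gradient C.
have m0 := enorm_gt0 D0.
have tau1 : enorm tau = 1 by rewrite enormZ ?invr_ge0 ?(ltW q0)// mulVf// lt0r_neq0.
have nutau : dot (nu x0) tau = 0 by rewrite dotZr dotC dot_tang// mulr0.
have Drtau : dot (Drho x0) tau = 0.
  apply/eqP; move: nutau; rewrite /nu (nbhs_singleton nuE)// dotZl => /eqP.
  by rewrite mulf_eq0 invr_eq0 gt_eqF.
have Dutau : dot (Du x0) tau = q.
  have -> : Du x0 = tang (Du x0) (nu x0) + dot (Du x0) (nu x0) *: nu x0 by rewrite subrK.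
  rewrite dotDl dotZl nutau mulr0 addr0 dotZr -enorm_sqr expr2 mulrA mulVf ?mul1r//.
  by rewrite lt0r_neq0.
have [X XP] := boundary_tangent_path oW bx0 C Drtau.
have Xx := tangent_path_cvg XP; have [Xb _] := XP.
have Xw : X t @[t --> 0^'+] --> within (boundary W) (nbhs x0).
  move=> V VV; have := Xx _ VV; move: Xb; apply: filterS2 => t Xb; exact.
have bDuc : {within boundary W, continuous Du}.
  by apply: continuous_subspaceW Duc => x [].
have nuX : nu (X t) @[t --> 0^'+] --> nu x0.
  have /subspace_continuousP/(_ _ bx0) H := inner_normal_continuous hW.
  exact: cvg_comp Xw H.
have DuX : Du (X t) @[t --> 0^'+] --> Du x0.
  move/subspace_continuousP : bDuc => /(_ _ bx0) H.
  exact: cvg_comp Xw H.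
have uX : t^-1 * (u (X t) - u x0) @[t --> 0^'+] --> q.
  rewrite -Dutau; apply: rel_diff_path XP.
  by apply: boundary_rel_diff oW bx0 C _ uc Duc => x /Dd[].
have DuXt : t^-1 * (dot (Du (X t)) tau - q) @[t --> 0^'+] --> dot (tau *m D2u x0) tau.
  rewrite -Dutau -dot_mulmx_tr.
  apply: (rel_diff_path (g := fun x => dot (Du x) tau)) XP.
  apply: (boundary_rel_diff (dg := fun x => tau *m (D2u x)^T)) oW bx0 C _ _ _.
  - by move=> x /Dd[_]; exact: is_diff_dot.
  - apply/subspace_continuousP => x clx; apply: cvg_dot; last exact: cvg_cst.
    by move/subspace_continuousP : Duc; exact.
  - apply/subspace_continuousP => x clx; apply: cvg_mulmx_tr.
    by move/subspace_continuousP : D2uc; exact.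
have rX : t^-1 * dot (Drho (X t)) tau @[t --> 0^'+] --> dot (tau *m D2rho x0) tau.
  rewrite -dot_mulmx_tr.
  have H := rel_diff_path (is_diff_rel_diff (boundary W) (is_diff_dot tau (D _ Ux0).2)) XP.
  apply: cvg_trans H; apply: near_eq_cvg; apply: nearW => t.
  by rewrite Drtau subr0.
(* As [dot (Drho x0) tau] vanishes, the normalizing factor enters only through its limit. *)
have nX : t^-1 * dot (nu (X t)) tau @[t --> 0^'+] -->
    dot (tau *m D2rho x0) tau / enorm (Drho x0).
  have Dre : (enorm (Drho (X t)))^-1 @[t --> 0^'+] --> (enorm (Drho x0))^-1.
    apply: cvgV; first by rewrite lt0r_neq0.
    by apply: cvg_enorm; exact: (continuous_cvg _ Drc Xx).
  have H : t^-1 * dot (Drho (X t)) tau * (enorm (Drho (X t)))^-1 @[t --> 0^'+] -->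
    dot (tau *m D2rho x0) tau / enorm (Drho x0).
    exact: cvgM rX Dre.
  apply: cvg_trans H; apply: near_eq_cvg.
  have := Xx _ nuE; move: Xb; apply: filterS2 => t bX /(_ bX) E.
  by rewrite /nu E dotZl /=; ring.
(* The factor [dot (nu (X t)) tau] vanishes at [x0], so continuity of [dot (Du (X t)) (nu (X t))]
   suffices. *)
have fX : t^-1 * (dot (Du (X t)) tau - dot (Du (X t)) (nu (X t)) * dot (nu (X t)) tau - q)
    @[t --> 0^'+] --> dot (tau *m D2u x0) tau -
    dot (Du x0) (nu x0) * (dot (tau *m D2rho x0) tau / enorm (Drho x0)).
  have H : t^-1 * (dot (Du (X t)) tau - q) -
      dot (Du (X t)) (nu (X t)) * (t^-1 * dot (nu (X t)) tau) @[t --> 0^'+] -->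
      dot (tau *m D2u x0) tau -
      dot (Du x0) (nu x0) * (dot (tau *m D2rho x0) tau / enorm (Drho x0)).
    exact: cvgB DuXt (cvgM (cvg_dot DuX nuX) nX).
  apply: cvg_trans H; apply: near_eq_cvg; apply: nearW => t /=.
  by rewrite -[LHS]/(_ - _ * _); ring.
apply: (exp_weighted_max_slope q0 fX uX K0).
move: Xb; apply: filterS => t /max0; apply: le_trans.
rewrite ler_wpM2r ?expR_ge0// -dot_tangE.
by apply: le_trans (ler_norm _) _; rewrite -[leRHS]mulr1 -tau1 cauchy_schwarz.
Qed.

Lemma interior_critical W x0 u Du D2u (K : R) :
  let q := enorm (Du x0) in
  let tau := q^-1 *: Du x0 in
  open W -> W x0 -> derivs2 W u Du D2u -> 0 <= K -> 0 < q ->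
  (forall x, W x -> enorm (Du x) * expR (K * u x) <= q * expR (K * u x0)) ->
  dot (tau *m D2u x0) tau + K * q ^+ 2 <= 0.
Proof.
move=> q tau oW Wx0 Dd K0 q0 max0.
have tau1 : enorm tau = 1 by rewrite enormZ ?invr_ge0 ?(ltW q0)// mulVf// lt0r_neq0.
have Dutau : dot (Du x0) tau = q.
  by rewrite dotZr -enorm_sqr expr2 mulrA mulVf ?mul1r// lt0r_neq0.
have [du dDu] := Dd _ Wx0.
have uX := is_diff_slope (h := tau) du; rewrite Dutau in uX.
have fX := is_diff_slope (h := tau) (is_diff_dot tau dDu).
rewrite dot_mulmx_tr Dutau in fX.
apply: (exp_weighted_max_slope q0 fX uX K0).
apply: filterS (near_straight tau oW Wx0) => t /max0; apply: le_trans.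
rewrite ler_wpM2r ?expR_ge0//.
by apply: le_trans (ler_norm _) _; rewrite -[leRHS]mulr1 -tau1 cauchy_schwarz.
Qed.

End Final.

(** * Boundary and global gradient bounds *)

Section Main.
Context {R : realType} {n : nat}.
Implicit Types (x y z e v w tau : 'rV[R]_n) (A W V N U : set 'rV[R]_n).

Lemma closure_boundary W x : open W -> closure W x -> W x \/ boundary W x.
Proof.
move=> /interior_id oW clx; have [Wx|Wx] := pselect (W x); first by left.
by right; split => //; rewrite oW.
Qed.

(** For a fixed [tau] both sides are continuous on the closure; the bound is needed at maximum
    points on the boundary. *)
Lemma closure_lower_hessian W u Du D2u (mu0 : R) x tau :
  C2_closure W u Du D2u ->
  (forall x, W x -> mx_le (- (mu0 * (1 + enorm (Du x) ^+ 2)))%:M (D2u x)) ->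
  closure W x -> enorm tau = 1 ->
  - (mu0 * (1 + enorm (Du x) ^+ 2)) <= dot (tau *m D2u x) tau.
Proof.
move=> [_ _ /subspace_continuousP Duc /subspace_continuousP D2uc] H clx tau1.
rewrite -subr_ge0 opprK.
apply: (closure_le (W := W) (f := fun y => dot (tau *m D2u y) tau +
  mu0 * (1 + enorm (Du y) ^+ 2))) => //.
- apply/subspace_continuousP => y cly.
  apply: cvgD.
    under eq_fun do rewrite -dot_mulmx_tr.
    rewrite -dot_mulmx_tr; apply: cvg_dot; last exact: cvg_cst.
    by apply: cvg_mulmx_tr; exact: D2uc.
  apply: cvgMl_tmp; apply: cvgD; first exact: cvg_cst.
  by apply: cvgM; apply: cvg_enorm; exact: Duc.
move=> y Wy; have := H y Wy tau.
by rewrite mul_mx_scalar dotZl -enorm_sqr tau1 expr1n mulr1 -subr_ge0 opprK.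
Qed.

Lemma abs_bounded_closure W (u : 'rV[R]_n -> R) x :
  bounded_set W -> {within closure W, continuous u} -> closure W x ->
  `|u x| <= sup [set `|u y| | y in W].
Proof.
move=> bW uc clx.
have auc : {within closure W, continuous (fun y => `|u y|)}.
  apply/subspace_continuousP => y cly; apply: cvg_norm.
  by move/subspace_continuousP : uc; exact.
have [|c] := compact_EVT_max _ (compact_closure bW) auc; first by exists x.
rewrite inE => cc cmax.
(* Without an upper bound [sup] would be a default value; compactness of the closure provides
   one. *)
have ub : has_ubound [set `|u y| | y in W].
  exists `|u c| => _ [y Wy <-]; apply: cmax; rewrite inE; exact: subset_closure.
rewrite -lerN2.
apply: (closure_le (W := W) (f := fun y => - `|u y|)) => //.
  apply/subspace_continuousP => y cly; apply: cvgN.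
  by move/subspace_continuousP : auc; exact.
move=> y Wy; rewrite lerN2; apply: ub_le_sup => //.
by exists y.
Qed.

(** When [q > 1], obliqueness bounds the normal derivative by [B q]. The Hessian then loses at most
    [mu0 (2 + B^2) q^2] and the curvature term [kappa B q^2]; the final 1 leaves [q^2 > 0]. *)
Definition tangential_weight (kappa mu0 sigma0 beta0 : R) : R :=
  let B := (sigma0 + 1) / beta0 in mu0 * (2 + B ^+ 2) + kappa * B + 1.

(** [T] bounds the tangential part and the quotient bounds the normal part, by obliqueness. *)
Definition boundary_bound (kappa mu0 sigma0 beta0 M : R) : R :=
  let T := expR (2 * tangential_weight kappa mu0 sigma0 beta0 * M) in
  T + (sigma0 + T) / beta0.

Lemma boundary_gradient_bound W : bounded_C2_domain W ->
  exists kappa : R, forall (mu0 sigma0 beta0 : R) u Du D2u beta,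
    0 <= mu0 -> 0 < sigma0 -> 0 < beta0 -> C2_closure W u Du D2u ->
    (forall x, W x -> mx_le (- (mu0 * (1 + enorm (Du x) ^+ 2)))%:M (D2u x)) ->
    boundary_ae W (fun x => enorm (beta x) = 1) ->
    boundary_ae W (fun x => `|dot (beta x) (Du x)| <= sigma0) ->
    boundary_ae W (fun x => beta0 <= dot (beta x) (inner_normal W x)) ->
    forall x, boundary W x -> enorm (Du x) <=
      boundary_bound kappa mu0 sigma0 beta0 (sup [set `|u y| | y in W]).
Proof.
move=> hW; have [kappa kappa0 kP] := uniform_curvature hW; exists kappa.
move=> mu0 sigma0 beta0 u Du D2u beta mu00 s0 b0 hu hD b1 bD bnu.
have [_ oW _ bW _] := hW; have [Dd uc Duc D2uc] := hu.
have obl := oblique_boundary hW Duc b1 bD bnu.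
rewrite /boundary_bound; set K := tangential_weight _ _ _ _; set M := sup _.
set T := expR _.
pose B := (sigma0 + 1) / beta0.
have B0 : 0 <= B by rewrite divr_ge0 ?addr_ge0// ltW.
have KE : K = mu0 * (2 + B ^+ 2) + kappa * B + 1 by [].
have K0 : 0 <= K.
  have h1 : 0 <= mu0 * (2 + B ^+ 2) by rewrite mulr_ge0// addr_ge0// sqr_ge0.
  have h2 : 0 <= kappa * B by rewrite mulr_ge0.
  by rewrite KE; lra.
have sub x : boundary W x -> closure W x by case.
have tle : forall x, boundary W x -> enorm (tang (Du x) (inner_normal W x)) <= T.
  move=> x bx; rewrite -[T]mul1r.
  apply: (@weighted_max _ _ (boundary W) (fun x => enorm (tang (Du x) (inner_normal W x))) u) => //.
  - exact: compact_boundary.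
  - apply: tang_continuous; last exact: inner_normal_continuous.
    exact: continuous_subspaceW Duc.
  - exact: continuous_subspaceW uc.
  - by move=> y bdy; exact: abs_bounded_closure bW uc (sub _ bdy).
  move=> x0 bx0 max0; rewrite leNgt; apply/negP => q1.
  have [U [rho [Drho [D2rho [C Ux0 oU D kle]]]]] := kP _ bx0.
  have q0 := lt_trans ltr01 q1.
  have := tangential_critical hW bx0 hu C Ux0 D K0 q0 max0.
  have /= := enorm_sqr_tang (Du x0) (enorm_inner_normal hW bx0).
  have := obl _ bx0.
  have [_ D0] := C2_defining_gradient C.
  have m0 := enorm_gt0 D0.
  move: q0 q1; set q := enorm (tang _ _) => q0 q1.
  set tau := q^-1 *: _.
  have tau1 : enorm tau = 1 by rewrite enormZ ?invr_ge0 ?(ltW q0)// mulVf// lt0r_neq0.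
  have := closure_lower_hessian hu hD (sub _ bx0) tau1.
  have := kle _ tau1; rewrite -ler_pdivrMr//.
  rewrite -[X in _ / X](gtr0_norm m0) -normf_div.
  set k := _ / enorm (Drho x0); set d := dot (tau *m D2u x0) tau.
  set s := dot (Du x0) _ => kk dd os E crit.
  rewrite E in dd.
  have sB : `|s| <= B * q.
    rewrite /B mulrAC ler_pdivlMr// mulrC; apply: le_trans os _.
    rewrite mulrDl mul1r lerD2r ler_peMr// ltW//.
  have s2 : s ^+ 2 <= B ^+ 2 * q ^+ 2.
    have Bq : 0 <= B * q by rewrite mulr_ge0// ltW.
    by rewrite -exprMn -[s ^+ 2]real_normK ?num_real// ler_sqr ?nnegrE.
  have sk : s * k <= kappa * B * q ^+ 2.
    apply: le_trans (ler_norm _) _; rewrite normrM mulrC.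
    apply: le_trans (_ : kappa * (B * q) <= _); first by rewrite ler_pM.
    rewrite -mulrA ler_wpM2l// ler_wpM2l// expr2 ler_peMr// ltW//.
  have q2 : 1 < q ^+ 2 by rewrite exprn_egt1.
  have ms := ler_wpM2l mu00 s2.
  have mq := ler_wpM2l mu00 (ltW q2).
  move: crit; rewrite KE.
  lra.
move=> x bx; have T0 : 0 < T by exact: expR_gt0.
have t1 := tle _ bx; have := obl _ bx.
have := enorm_sqr_tang (Du x) (enorm_inner_normal hW bx).
set q := enorm (tang _ _) in t1 *; set s := dot _ _ => E os.
have sT : `|s| <= (sigma0 + T) / beta0.
  by rewrite ler_pdivlMr// mulrC (le_trans os)// lerD2l.
have q0 : 0 <= q by exact: enorm_ge0.
apply: le_trans (_ : q + `|s| <= _); last exact: lerD.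
rewrite -ler_sqr ?nnegrE ?enorm_ge0 ?addr_ge0// E sqrrD real_normK ?num_real//.
by rewrite lerD2r lerDl mulrn_wge0// mulr_ge0.
Qed.

End Main.

Unset Implicit Arguments.

Theorem lemma4p1 (R : realType) (n : nat) (hn : (0 < n)%N)
    (Omega : set 'rV[R]_n) (hOmega : bounded_C2_domain Omega) :
  exists C : R -> R -> R -> R -> R,
    forall (mu0 sigma0 beta0 : R) (u : 'rV[R]_n -> R)
      (Du : 'rV[R]_n -> 'rV[R]_n) (D2u : 'rV[R]_n -> 'M[R]_n)
      (beta : 'rV[R]_n -> 'rV[R]_n),
    0 <= mu0 -> 0 < sigma0 -> 0 < beta0 ->
    C2_closure Omega u Du D2u ->
    (forall x, Omega x ->
       mx_le (- (mu0 * (1 + enorm (Du x) ^+ 2)))%:M (D2u x)) ->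
    boundary_Linfty Omega beta ->
    boundary_ae Omega (fun x => enorm (beta x) = 1) ->
    boundary_ae Omega (fun x => `|dot (beta x) (Du x)| <= sigma0) ->
    boundary_ae Omega (fun x => beta0 <= dot (beta x) (inner_normal Omega x)) ->
    forall x, Omega x ->
      enorm (Du x) <= C mu0 sigma0 beta0 (sup [set `|u y| | y in Omega]).
Proof.
have [kappa bdry] := boundary_gradient_bound hOmega.
(* At an interior maximum with [q > 1] the Hessian term is at least [- 2 mu0 q^2], so the weight
   [2 mu0 + 1] leaves [q^2 > 0]. The prefactor covers both cases: gradient at most 1 at an interior
   maximum, at most [boundary_bound] at a boundary one. *)
exists (fun mu0 sigma0 beta0 M =>
  (1 + boundary_bound kappa mu0 sigma0 beta0 M) * expR (2 * (2 * mu0 + 1) * M)).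
move=> mu0 sigma0 beta0 u Du D2u beta mu00 s0 b0 hu hD _ b1 bD bnu x Wx.
have [_ oW _ bW _] := hOmega; have [Dd uc Duc D2uc] := hu.
have bbd := bdry _ _ _ _ _ _ _ mu00 s0 b0 hu hD b1 bD bnu.
set M := sup _ in bbd *.
have bb0 : 0 <= boundary_bound kappa mu0 sigma0 beta0 M.
  have T0 := expR_ge0 (2 * tangential_weight kappa mu0 sigma0 beta0 * M).
  by apply: addr_ge0 => //; apply: divr_ge0; [apply: addr_ge0 => //; exact: ltW|exact: ltW].
have K0 : 0 <= 2 * mu0 + 1 by lra.
apply: (@weighted_max _ _ (closure Omega) (fun x => enorm (Du x)) u) => //.
- exact: compact_closure.
- apply/subspace_continuousP => y cly; apply: cvg_enorm.
  by move/subspace_continuousP : Duc; exact.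
- by rewrite addr_ge0.
- by move=> y cly; exact: abs_bounded_closure bW uc cly.
- move=> x0 clx0 max0.
  have [Wx0|bx0] := closure_boundary oW clx0; last first.
    by apply: le_trans (bbd _ bx0) _; rewrite lerDr.
  apply: le_trans (_ : 1 <= _); last by rewrite lerDl.
  rewrite leNgt; apply/negP => q1.
  have q0 := lt_trans ltr01 q1.
  have max0' y : Omega y -> enorm (Du y) * expR ((2 * mu0 + 1) * u y) <=
      enorm (Du x0) * expR ((2 * mu0 + 1) * u x0).
    by move=> Wy; apply: max0; exact: subset_closure.
  have := interior_critical oW Wx0 Dd K0 q0 max0'.
  set tau := _^-1 *: _.
  have tau1 : enorm tau = 1 by rewrite enormZ ?invr_ge0 ?(ltW q0)// mulVf// lt0r_neq0.
  have := closure_lower_hessian hu hD clx0 tau1.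
  have q2 : 1 < enorm (Du x0) ^+ 2 by rewrite exprn_egt1.
  have mq := ler_wpM2l mu00 (ltW q2).
  lra.
- exact: subset_closure.
Qed.
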